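(* Let $\Phi$ be a finite or affine simply-laced root system with positive roots $\Phi^+$ in the vector space $V$. Take any ordering $\gamma_1,\gamma_2,\gamma_3,\ldots$ of $\Phi^+$ which refines the root poset on $\Phi^+$. Then this ordering is suitable (as an ordering of the set $X=\Phi^+\subseteq V$).
   Context: Root systems are (symmetrizable, crystallographic, real, reduced) root systems in a real vector space $V$ with symmetric bilinear form, base $\Pi$, positive roots $\Phi^+=\Phi\cap\mathrm{Span}_+\Pi$ ($\mathrm{Span}_+$ = nonnegative combinations); affine root systems have all irreducible components finite or affine (at least one affine), imaginary roots excluded; simply-laced means all Cartan matrix entries off the diagonal are $0$ or $-1$ (types $A,D,E$ and their affine versions, including $\widetilde A_n$). Root poset: $\alpha\le\beta$ iff $\beta-\alpha\in\mathrm{Span}_+\Pi$. For $Z\subseteq V$, $B\subseteq Z$: closed in $Z$ if $\alpha,\beta\in B$, $\gamma\in\mathrm{Span}_+(\alpha,\beta)\cap Z$ imply $\gamma\in B$; coclosed if $Z\setminus B$ closed; biclosed if both; weakly separable if $\mathrm{Span}_+(B)\cap\mathrm{Span}_+(Z\setminus B)=\{0\}$; $Z$ clean if every biclosed subset is weakly separable. For $X\subseteq V$: a linear subset is $X\cap L$ for a subspace $L$; a $2$-dimensional linear subset $Y$ has fundamental vectors $\alpha,\beta\in Y$ if $Y\subseteq\mathrm{Span}_+\{\alpha,\beta\}$ and neither lies in the nonnegative span of the other elements of $Y$; $F\subseteq X$ is full if $F\cap\mathrm{Span}\{\alpha,\beta\}=X\cap\mathrm{Span}\{\alpha,\beta\}$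 for all $\alpha,\beta\in F$. An ordering $\gamma_1,\gamma_2,\ldots$ of $X$ with initial segments $X_i=\{\gamma_1,\ldots,\gamma_i\}$ is suitable if (1) in every $2$-dimensional linear subset the fundamental vectors precede all its other vectors, and (2) for every $i$ and $\alpha,\beta,\gamma\in X_i$ there is a full $F\subseteq X$ containing them with $F\cap X_i$ clean. *)

(* Defs.v *)
From HB Require Import structures.
From mathcomp Require Import all_boot all_order all_algebra.
From mathcomp Require Import reals.
Set Implicit Arguments. Unset Strict Implicit. Unset Printing Implicit Defensive.
Import Order.TTheory GRing.Theory Num.Theory.
Local Open Scope ring_scope.

Section Defs.
Variables (R : realType) (n : nat).
Notation V := 'rV[R]_n.

Definition nspan (B : V -> Prop) (v : V) : Prop :=
  exists s : seq (R * V),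
    (forall p, p \in s -> 0 <= p.1 /\ B p.2) /\
    v = \sum_(p <- s) p.1 *: p.2.

Definition lspan (B : V -> Prop) (v : V) : Prop :=
  exists s : seq (R * V),
    (forall p, p \in s -> B p.2) /\
    v = \sum_(p <- s) p.1 *: p.2.

Definition pair_set (a b : V) : V -> Prop := fun x => x = a \/ x = b.

Definition setminus (Z B : V -> Prop) : V -> Prop := fun x => Z x /\ ~ B x.

Definition subset (B Z : V -> Prop) : Prop := forall x, B x -> Z x.

Definition closed_in (Z B : V -> Prop) : Prop :=
  subset B Z /\
  forall a b c, B a -> B b -> nspan (pair_set a b) c -> Z c -> B c.

Definition coclosed_in (Z B : V -> Prop) : Prop := closed_in Z (setminus Z B).

Definition biclosed_in (Z B : V -> Prop) : Prop :=
  closed_in Z B /\ coclosed_in Z B.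

Definition weakly_separable (Z B : V -> Prop) : Prop :=
  forall v, nspan B v -> nspan (setminus Z B) v -> v = 0.

Definition clean (Z : V -> Prop) : Prop :=
  forall B, subset B Z -> biclosed_in Z B -> weakly_separable Z B.

Definition lin_indep2 (a b : V) : Prop :=
  forall x y : R, x *: a + y *: b = 0 -> x = 0 /\ y = 0.

(* Y is a 2-dimensional linear subset of X, i.e. Y = X ∩ L for a subspace L
   and Span Y has dimension 2 (equivalently Y = X ∩ Span{a,b} with a,b ∈ X
   linearly independent). *)
Definition two_dim_linear_subset (X Y : V -> Prop) : Prop :=
  exists a b, X a /\ X b /\ lin_indep2 a b /\
    forall v, Y v <-> (X v /\ lspan (pair_set a b) v).

Definition fundamental_vectors (Y : V -> Prop) (a b : V) : Prop :=
  Y a /\ Y b /\ subset Y (nspan (pair_set a b)) /\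
  ~ nspan (fun x => Y x /\ x <> a) a /\
  ~ nspan (fun x => Y x /\ x <> b) b.

Definition full (X F : V -> Prop) : Prop :=
  subset F X /\
  forall a b, F a -> F b ->
    forall v, lspan (pair_set a b) v -> (F v <-> X v).

(* An ordering gamma_1, gamma_2, ... of X is encoded by the position map
   r : V -> nat (gamma_{k+1} is the x in X with r x = k): r is injective on X
   and its image on X is an initial segment of nat. *)
Definition ordering (X : V -> Prop) (r : V -> nat) : Prop :=
  (forall x y, X x -> X y -> r x = r y -> x = y) /\
  (forall x k, X x -> (k < r x)%N -> exists y, X y /\ r y = k).

Definition init_seg (X : V -> Prop) (r : V -> nat) (i : nat) : V -> Prop :=
  fun x => X x /\ (r x < i)%N.

Definition suitable (X : V -> Prop) (r : V -> nat) : Prop :=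
  (forall Y, two_dim_linear_subset X Y ->
     forall a b, fundamental_vectors Y a b ->
       forall c, Y c -> c <> a -> c <> b ->
         (r a < r c)%N /\ (r b < r c)%N) /\
  (forall i a b c,
     init_seg X r i a -> init_seg X r i b -> init_seg X r i c ->
     exists F, full X F /\ F a /\ F b /\ F c /\
       clean (fun x => F x /\ init_seg X r i x)).

Definition simple_root (i : 'I_n) : V := delta_mx 0 i.

Definition Pi (v : V) : Prop := exists i, v = simple_root i.

Definition form (A : 'M[int]_n) (u v : V) : R :=
  (u *m map_mx (fun z : int => z%:~R) A *m v^T) 0 0.

(* simple reflection s_i(v) = v - 2 (v, a_i)/(a_i, a_i) a_i = v - (v, a_i) a_i *)
Definition refl (A : 'M[int]_n) (i : 'I_n) (v : V) : V :=
  v - form A v (simple_root i) *: simple_root i.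

(* real roots Phi = W Pi *)
Inductive is_root (A : 'M[int]_n) : V -> Prop :=
  | root_simple i : is_root A (simple_root i)
  | root_refl i v : is_root A v -> is_root A (refl A i v).

Definition pos_root (A : 'M[int]_n) (v : V) : Prop :=
  is_root A v /\ nspan Pi v.

Definition simply_laced_cartan (A : 'M[int]_n) : Prop :=
  (forall i, A i i = 2) /\
  (forall i j, i != j -> A i j = 0 \/ A i j = -1) /\
  (forall i j, A i j = A j i).

(* every irreducible component is of finite or affine type; for symmetric
   GCMs this is positive semidefiniteness of the form *)
Definition finite_or_affine (A : 'M[int]_n) : Prop :=
  forall v : V, 0 <= form A v v.

Definition root_le (a b : V) : Prop := nspan Pi (b - a).

Definition refines_root_poset (A : 'M[int]_n) (r : V -> nat) : Prop :=
  forall a b, pos_root A a -> pos_root A b -> a <> b -> root_le a b ->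
    (r a < r b)%N.

End Defs.

(* Main.v *)
Require Import Defs.
From HB Require Import structures.
From mathcomp Require Import all_boot all_order all_algebra.
From mathcomp Require Import boolp reals.
From mathcomp Require Import ring lra zify.
Set Implicit Arguments. Unset Strict Implicit. Unset Printing Implicit Defensive.
Import Order.TTheory GRing.Theory Num.Theory.
Local Open Scope ring_scope.

(* Positive roots x, y with (x, y) = 1 differ by a root, and (x, y) = 2 means that x - y is
   isotropic. Three roots span a space that is either definite, or has one isotropic
   direction, and then the subsystem is of type A2~ or a (possibly enlarged) A1~.

   Let Z be an order ideal of a subsystem, B biclosed in Z and C = Z - B. If the cones of B
   and C meet, rationality gives lists of elements of B and of C with equal sum v. When
   (b, c) = 1 for b, c in these lists, one of b - c, c - b is a positive root, lies in Z, and
   belongs to B, resp. C; replacing the pair by it lowers the height of v. So eventually all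
   (b, c) <= 0, whence (v, v) <= 0 and v is isotropic: impossible in the definite case.

   In type A2~, each class {x + k delta} may change colour between B and C only in the
   same sense (say, from C to B as k grows). Pairs with (b, c) = 2 are then absorbed into
   a nonnegative multiple of delta, and the process ends with delta in the cone of C, which
   contradicts the presence of such a colour change. *)

(** Condition (1) of suitability is a rank-two matter: every other root of the plane lies above both
    fundamental vectors in the root poset. In condition (2) the ordering enters through one fact:
    its initial segments are order ideals, so a root obtained by subtraction never leaves [Z]. The
    descent acts on finite lists and lowers a height, hence the passage from real to integer
    coefficients. Two obstacles shape the rest. A pair with [(b, c) = 2] differs by an isotropic
    vector, which is no root and has no colour; it can only be kept as a separate term, and this is
    harmless only if all such terms fall on the same side of the relation. Hence the control over
    the sense of colour changes. Moreover, the base of a subsystem of type A2~ need not consist of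
    simple roots of the ambient system; it is found as a triple of positive roots of least total
    height, the existence of such triples coming from translations in the Weyl group. *)

Lemma one_le0F (R : realType) : (1 : R) <= 0 -> False.
Proof. by move=> h; lra. Qed.

(** Here [p], [q] are coordinates of a root in roots [a], [b] with [(a, b) = -1]: the arguments of
    [D] are its pairings with [a] and [b], the quadratic expression is half its norm. The solutions
    are the six roots of A2, grouped as [a], [b], [-(a + b)] and their opposites. *)
Lemma hexagon_coord (R : realType) (p q : R) :
  let D (z : R) := z = 0 \/ z = 1 \/ z = - 1 \/ z = 2 \/ z = - 2 in
  D (2 * p - q) -> D (2 * q - p) -> p * p - p * q + q * q = 1 ->
  [\/ p = 1 /\ q = 0, p = 0 /\ q = 1 | p = -1 /\ q = -1] \/
  [\/ p = -1 /\ q = 0, p = 0 /\ q = -1 | p = 1 /\ q = 1].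
Proof.
move=> D h1 h2 h.
have ep : p = (2 * (2 * p - q) + (2 * q - p)) / 3 by field.
have eq : q = (2 * (2 * q - p) + (2 * p - q)) / 3 by field.
case: h1 => [|[|[|[|]]]] h1; case: h2 => [|[|[|[|]]]] h2; rewrite h1 h2 in ep eq;
rewrite ep eq in h *; try (by exfalso; apply: (@one_le0F R); lra).
all: solve [by left; constructor 1; split; lra | by left; constructor 2; split; lra
 | by left; constructor 3; split; lra | by right; constructor 1; split; lra
 | by right; constructor 2; split; lra | by right; constructor 3; split; lra].
Qed.

(** The same for an orthogonal pair: the coordinates lie in 0, ±1/2, ±1, and two nonzero ones have
    squares summing to 1/2, 5/4 or 2. *)
Lemma square_coord (R : realType) (p q : R) :
  let D (z : R) := z = 0 \/ z = 1 \/ z = - 1 \/ z = 2 \/ z = - 2 in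
  D (2 * p) -> D (2 * q) -> p * p + q * q = 1 -> p = 0 \/ q = 0.
Proof.
move=> D h1 h2 h.
have ep : p = (2 * p) / 2 by field.
have eq : q = (2 * q) / 2 by field.
case: h1 => [|[|[|[|]]]] h1; case: h2 => [|[|[|[|]]]] h2; rewrite h1 in ep; rewrite h2 in eq;
rewrite ep eq in h *; try (by left; lra); try (by right; lra);
by exfalso; apply: (@one_le0F R); lra.
Qed.

Lemma sqr_eq1_pos (R : realType) (z : R) : 0 <= z -> z * z = 1 -> z = 1.
Proof. by move=> *; nra. Qed.

(** * Positive integer solutions of linear relations *)

Lemma rat_common_denominator (k : nat) (q : 'rV[rat]_k) :
  exists2 d : int, 0 < d & exists m : 'rV[int]_k, map_mx intr m = d%:~R *: q.
Proof.
exists (\prod_j denq (q 0 j)); first by apply: prodr_gt0 => j _; apply: denq_gt0.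
exists (\row_i (numq (q 0 i) * \prod_(j | j != i) denq (q 0 j))).
apply/rowP => i; rewrite !mxE [in RHS](bigD1 i) //= !intrM mulrAC; congr (_ * _).
by rewrite numqE mulrC.
Qed.

(* The kernel of an integer matrix has a rational basis, so its rational points
   are dense in its real points. *)
Lemma positive_int_relation (R : realType) (k n : nat) (U : 'M[int]_(k, n)) (x : 'rV[R]_k) :
  (forall i, 0 < x 0 i) -> x *m map_mx intr U = 0 ->
  exists m : 'rV[int]_k, (forall i, 0 < m 0 i) /\ m *m U = 0.
Proof.
move=> x_gt0 xU.
pose Uq : 'M[rat]_(k, n) := map_mx intr U; pose K := kermx Uq.
have UqR : map_mx (ratr : rat -> R) Uq = map_mx intr U.
  by apply/matrixP => i j; rewrite !mxE ratr_int.
have /submxP[y xE] : (x <= map_mx (ratr : rat -> R) K)%MS.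
  by rewrite map_kermx UqR; apply/sub_kermxP.
(* A positive lower bound for all coordinates of [x], valid also when there are none. *)
pose e : R := (1 + \sum_i (x 0 i)^-1)^-1.
have e0 : 0 < 1 + \sum_i (x 0 i)^-1.
  by rewrite ltr_wpDr // sumr_ge0 // => i _; rewrite invr_ge0 ltW.
have e_gt0 : 0 < e by rewrite invr_gt0.
have e_le i : e <= x 0 i.
  rewrite -[leRHS]invrK lef_pV2 ?posrE ?invr_gt0 // (bigD1 i) //=.
  rewrite addrCA lerDl addr_ge0 // sumr_ge0 // => j _; by rewrite invr_ge0 ltW.
(* [M - 1] dominates every column sum of absolute values of [K], so moving each coordinate of [y] by
   less than [e / M] moves those of [y *m K] by less than [e]. *)
pose M : R := 1 + \sum_i \sum_j `|ratr (K j i)|.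
have M_gt0 : 0 < M.
  by rewrite ltr_wpDr // sumr_ge0 // => i _; rewrite sumr_ge0.
have eM_gt0 : 0 < e / M by rewrite divr_gt0.
have /fin_all_exists[z hz] (j : 'I_k) :
    exists z : rat, `|y 0 j - ratr z| < e / M.
  have [|z] := @rat_in_itvoo R (y 0 j - e / M) (y 0 j + e / M); first by lra.
  by rewrite in_itv /= => /andP[h1 h2]; exists z; rewrite ltr_norml; lra.
pose q := (\row_j z j) *m K.
have q_gt0 i : 0 < q 0 i.
  rewrite -(ltr0q R).
  have qE : ratr (q 0 i) = \sum_j ratr (z j) * ratr (K j i) :> R.
    by rewrite mxE rmorph_sum; apply: eq_bigr => j _; rewrite rmorphM mxE.
  have xEi : x 0 i = \sum_j y 0 j * ratr (K j i).
    by rewrite {1}xE mxE; apply: eq_bigr => j _; rewrite mxE.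
  have h : x 0 i - ratr (q 0 i) < e.
    rewrite qE xEi -sumrB; apply: le_lt_trans (_ : e / M * (M - 1) < _).
      apply: (@le_trans _ _ (\sum_j e / M * `|ratr (K j i)|)).
        apply: ler_sum => j _; rewrite -mulrBl; apply: le_trans (ler_norm _) _.
        by rewrite normrM ler_wpM2r // ltW.
      rewrite -mulr_sumr ler_wpM2l ?(ltW eM_gt0) // /M addrAC subrr add0r.
      by rewrite [leRHS](bigD1 i) //= lerDl sumr_ge0 // => l _; rewrite sumr_ge0.
    by rewrite mulrBr divfK ?gt_eqF // mulr1; lra.
  by have := e_le i; lra.
have qU : q *m Uq = 0 by rewrite -mulmxA mulmx_ker mulmx0.
have [d d_gt0 [m mE]] := rat_common_denominator q.
exists m; split=> [i|].
  have := congr1 (fun w : 'rV[rat]_k => w 0 i) mE; rewrite !mxE => mi.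
  have := mulr_gt0 (_ : 0 < d%:~R :> rat) (q_gt0 i); rewrite ltr0z => /(_ d_gt0).
  by move: mi; rewrite mxE => <-; rewrite ltr0z.
have mU : map_mx (intr : int -> rat) (m *m U) = 0.
  by rewrite map_mxM mE -scalemxAl qU scaler0.
apply/matrixP => i j; have := congr1 (fun w : 'M[rat]_(1, n) => w i j) mU.
by rewrite mxE [RHS]mxE => /eqP; rewrite intr_eq0 mxE [X in _ = X]mxE => /eqP.
Qed.

(** * The bilinear form, heights and integral vectors *)

Section RootSystem.
Variables (R : realType) (n : nat) (A : 'M[int]_n).
Notation V := 'rV[R]_n.
Implicit Types (u v w x y z a b c k : V) (i j : 'I_n) (s : seq V).

Notation "''[' u , v ]" := (Defs.form A u v) : ring_scope.

Lemma formE u v : '[u, v] = \sum_i \sum_j u 0 j * (A j i)%:~R * v 0 i.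
Proof.
rewrite /Defs.form mxE; apply: eq_bigr => i _; rewrite !mxE big_distrl /=.
by apply: eq_bigr => j _; rewrite mxE.
Qed.

Lemma formDl u v w : '[u + v, w] = '[u, w] + '[v, w].
Proof. by rewrite /Defs.form !mulmxDl mxE. Qed.
Lemma formDr u v w : '[w, u + v] = '[w, u] + '[w, v].
Proof. by rewrite /Defs.form linearD mulmxDr mxE. Qed.
Lemma formZl (p : R) u w : '[p *: u, w] = p * '[u, w].
Proof. by rewrite /Defs.form -!scalemxAl mxE. Qed.
Lemma formZr (p : R) u w : '[w, p *: u] = p * '[w, u].
Proof. by rewrite /Defs.form linearZ -scalemxAr mxE. Qed.
Lemma formNl u w : '[- u, w] = - '[u, w].
Proof. by rewrite -scaleN1r formZl mulN1r. Qed.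
Lemma formNr u w : '[w, - u] = - '[w, u].
Proof. by rewrite -scaleN1r formZr mulN1r. Qed.
Lemma form0l w : '[0, w] = 0.
Proof. by rewrite -(scale0r 0) formZl mul0r. Qed.
Lemma form0r w : '[w, 0] = 0.
Proof. by rewrite -(scale0r 0) formZr mul0r. Qed.

Definition formlin := (formDl, formDr, formNl, formNr, formZl, formZr, form0l, form0r).

Lemma form_suml s w : '[\sum_(x <- s) x, w] = \sum_(x <- s) '[x, w].
Proof.
by elim: s => [|x s IH]; rewrite ?(big_nil, big_cons) ?form0l // formDl IH.
Qed.

Definition nonneg v := forall i, 0 <= v 0 i.

Lemma nonnegD u v : nonneg u -> nonneg v -> nonneg (u + v).
Proof. by move=> hu hv i; rewrite mxE addr_ge0. Qed.
Lemma nonnegZ (p : R) v : 0 <= p -> nonneg v -> nonneg (p *: v).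
Proof. by move=> hp hv i; rewrite mxE mulr_ge0. Qed.
Lemma nonneg0 : nonneg 0.
Proof. by move=> i; rewrite mxE. Qed.

Lemma nspan_PiE v : nspan (@Pi R n) v <-> nonneg v.
Proof.
split=> [[s [hs ->]]|hv].
  elim: s hs => [|p s IH] hs; first by rewrite big_nil; apply: nonneg0.
  rewrite big_cons; apply: nonnegD.
    have [hp [i ->]] := hs p (mem_head _ _); apply: nonnegZ => // j.
    by rewrite mxE; case: (_ && _).
  by apply: IH => q hq; apply: hs; rewrite in_cons hq orbT.
exists [seq (v 0 i, simple_root R i) | i <- enum 'I_n]; split.
  by move=> p /mapP[i _ ->]; split; [exact: hv | exists i].
rewrite big_map big_enum /= {1}(row_sum_delta v).
by apply: eq_bigr.
Qed.

Definition ht v : R := \sum_i v 0 i.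

Lemma htD u v : ht (u + v) = ht u + ht v.
Proof. by rewrite /ht -big_split; apply: eq_bigr => i _; rewrite mxE. Qed.
Lemma htZ (p : R) v : ht (p *: v) = p * ht v.
Proof. by rewrite /ht big_distrr; apply: eq_bigr => i _; rewrite mxE. Qed.
Lemma htN v : ht (- v) = - ht v.
Proof. by rewrite -scaleN1r htZ mulN1r. Qed.
Lemma ht_ge0 v : nonneg v -> 0 <= ht v.
Proof. by move=> hv; apply: sumr_ge0 => i _; apply: hv. Qed.
Lemma ht_gt0 v : nonneg v -> v <> 0 -> 0 < ht v.
Proof.
move=> hv nv; rewrite lt_neqAle ht_ge0 // andbT eq_sym; apply/eqP => h; apply: nv.
apply/rowP => i; rewrite mxE.
have /eqP := h; rewrite psumr_eq0; last by move=> j _; apply: hv.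
by move/allP => /(_ i); rewrite mem_index_enum => /(_ isT) /eqP.
Qed.
Definition integral v := exists z : 'rV[int]_n, v = map_mx intr z.

Lemma integralB u v (m : int) : integral u -> integral v -> integral (u - m%:~R *: v).
Proof.
move=> [zu ->] [zv ->]; exists (zu - m *: zv).
by apply/rowP => i; rewrite !mxE intrD intrN intrM.
Qed.

Lemma simple_integral i : integral (simple_root R i).
Proof.
exists (delta_mx 0 i); apply/rowP => j; rewrite !mxE.
by case: (_ && _).
Qed.

Lemma form_integral u v : integral u -> integral v -> exists m : int, '[u, v] = m%:~R.
Proof.
move=> [zu ->] [zv ->].
exists (\sum_i \sum_j zu 0 j * A j i * zv 0 i); rewrite formE.
rewrite (rmorph_sum (intmul 1)); apply: eq_bigr => i _.
rewrite (rmorph_sum (intmul 1)); apply: eq_bigr => j _.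
by rewrite !mxE !rmorphM.
Qed.

Lemma form_simple u j : '[u, simple_root R j] = \sum_i u 0 i * (A i j)%:~R.
Proof.
rewrite formE (bigD1 j) //= [X in _ + X]big1 ?addr0; last first.
  move=> i ij; apply: big1 => l _; rewrite mxE eqxx /= eqE /= in ij *.
  by rewrite (negPf ij) mulr0.
by apply: eq_bigr => i _; rewrite !mxE !eqxx mulr1.
Qed.

Hypothesis hA : simply_laced_cartan A.
Hypothesis hpsd : @finite_or_affine R n A.

Let hA1 := proj1 hA.
Let hA2 := proj1 (proj2 hA).
Let hA3 := proj2 (proj2 hA).

Lemma offdiag_le0 i j : i != j -> ((A i j)%:~R : R) <= 0.
Proof. by move=> /hA2[] ->; lra. Qed.

Lemma formC u v : '[u, v] = '[v, u].
Proof.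
rewrite !formE exchange_big; apply: eq_bigr => i _; apply: eq_bigr => j _ /=.
by rewrite hA3; ring.
Qed.

Lemma form_simple_simple i : '[simple_root R i, simple_root R i] = 2.
Proof.
rewrite form_simple (bigD1 i) //= mxE !eqxx hA1 big1 ?addr0 ?mul1r //.
by move=> j ji; rewrite mxE (negPf ji) andbF mul0r.
Qed.

(** * The radical and the components of the diagram *)

Definition rad v := forall w, '[v, w] = 0.

Lemma radD u v : rad u -> rad v -> rad (u + v).
Proof. by move=> hu hv w; rewrite formDl hu hv addr0. Qed.
Lemma radZ (p : R) v : rad v -> rad (p *: v).
Proof. by move=> hv w; rewrite formZl hv mulr0. Qed.
Lemma radN v : rad v -> rad (- v).
Proof. by move=> hv w; rewrite formNl hv oppr0. Qed.
Lemma rad_r v : rad v -> forall w, '[w, v] = 0.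
Proof. by move=> h w; rewrite formC h. Qed.

Lemma isotropic_rad v : '[v, v] <= 0 -> rad v.
Proof.
move=> hv w; have {hv} hv : '[v, v] = 0 by apply/le_anti; rewrite hv hpsd.
pose p := '[v, w]; pose q := '[w, w].
have h t : 0 <= t * p *+ 2 + t ^+ 2 * q.
  have := hpsd (t *: w + v).
  rewrite !formlin hv (formC w v) -/p -/q => h.
  by apply: le_trans h _; rewrite le_eqVlt; apply/orP; left; apply/eqP; ring.
have q0 : 0 <= q by apply: hpsd.
(* The true minimiser [- p / q] fails for [q = 0]; with [1 + q] the value is still a nonpositive
   multiple of a square. *)
have := h (- p / (1 + q)).
have -> : - p / (1 + q) * p *+ 2 + (- p / (1 + q)) ^+ 2 * q
  = - (p / (1 + q)) ^+ 2 * (2 + q) by field; rewrite gt_eqF //; lra.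
move=> h1.
have h2 : 0 <= (p / (1 + q)) ^+ 2 by apply: sqr_ge0.
have h3 : (p / (1 + q)) ^+ 2 = 0 by nra.
move/eqP: h3; rewrite sqrf_eq0 mulf_eq0 invr_eq0 => /orP[/eqP //|/eqP]; lra.
Qed.

Lemma form_split v w (D : pred 'I_n) :
  (forall i j, D i -> ~~ D j -> A i j = 0) ->
  (forall i, ~~ D i -> v 0 i = 0) -> (forall i, D i -> w 0 i = 0) -> '[v, w] = 0.
Proof.
move=> hD hv hw; rewrite formE big1 // => i _; rewrite big1 // => j _.
case Dj: (D j); last by rewrite hv ?Dj // !mul0r.
case Di: (D i); first by rewrite hw ?mulr0.
by rewrite hD ?Di // mulr0 mul0r.
Qed.

(** [D] is a union of components. Along the reflections that build a root, one on its own side keeps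
    the support there, and one on the other side acts trivially because the pairing vanishes. *)
Lemma root_split v (D : pred 'I_n) :
  (forall i j, D i -> ~~ D j -> A i j = 0) -> is_root A v ->
  (forall i, ~~ D i -> v 0 i = 0) \/ (forall i, D i -> v 0 i = 0).
Proof.
move=> hD; elim=> [i|i u _ IH].
  case Di: (D i); [left|right] => j Dj; rewrite mxE eqxx /=; case: eqP => // ji;
  by move: Dj; rewrite ji Di.
have sD j : D j -> forall l, ~~ D l -> (simple_root R j) 0 l = 0.
  by move=> Dj l Dl; rewrite mxE eqxx /=; case: eqP => // e; rewrite e Dj in Dl.
have sD' j : ~~ D j -> forall l, D l -> (simple_root R j) 0 l = 0.
  by move=> Dj l Dl; rewrite mxE eqxx /=; case: eqP => // e; rewrite -e Dl in Dj.
case: IH => IH; case Di: (D i); rewrite /refl.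
- by left=> j Dj; rewrite mxE IH // mxE mxE sD // mulr0 subr0.
- left=> j Dj; rewrite (form_split hD IH); first by rewrite scale0r subr0 IH.
  by apply: sD'; rewrite Di.
- right=> j Dj; rewrite formC (form_split hD (sD _ Di) IH) scale0r subr0 IH //.
- by right=> j Dj; rewrite mxE IH // mxE mxE sD' ?Di // mulr0 subr0.
Qed.

(** At a node [j] outside the support, the pairing with the simple root is a sum of nonpositive
    terms equal to 0, so each term vanishes. Hence the support is a union of components. *)
Lemma rad_nonneg_closed v : rad v -> nonneg v ->
  forall i j, v 0 i != 0 -> ~~ (v 0 j != 0) -> A i j = 0.
Proof.
move=> hr hv i j vi; rewrite negbK => /eqP vj.
have ij : i != j by apply: contraNneq vi => ->; rewrite vj.
have /eqP := hr (simple_root R j); rewrite form_simple => /eqP h.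
have h2 : \sum_l - (v 0 l * (A l j)%:~R) = 0 by rewrite sumrN h oppr0.
have /eqP := h2; rewrite psumr_eq0 => [/allP|l _].
  move=> /(_ i); rewrite mem_index_enum => /(_ isT) /=.
  by rewrite oppr_eq0 mulf_eq0 (negPf vi) /= intr_eq0 => /eqP.
have [->|lj] := eqVneq l j; first by rewrite vj mul0r oppr0.
by rewrite -mulrN mulr_ge0 // oppr_ge0 offdiag_le0.
Qed.

(** Off-diagonal entries are nonpositive, so taking absolute values cannot increase the norm. *)
Lemma rad_abs v : rad v -> rad (map_mx Num.norm v).
Proof.
move=> hv; apply: isotropic_rad; rewrite -(hv v) !formE.
apply: ler_sum => i _; apply: ler_sum => j _; rewrite !mxE.
have [->|ij] := eqVneq i j.
  rewrite mulrAC -expr2 [leRHS]mulrAC -expr2 real_normK ?num_real //.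
rewrite mulrAC [leRHS]mulrAC; apply: ler_wnM2r; first by rewrite offdiag_le0 // eq_sym.
by rewrite -normrM ler_norm.
Qed.

(** * Real roots: integrality, norms, reflections and signs *)

Lemma root_integral v : is_root A v -> integral v.
Proof.
elim=> [i|i u hu IH]; first exact: simple_integral.
have [m hm] := form_integral IH (simple_integral i).
by rewrite /refl hm; apply: integralB => //; apply: simple_integral.
Qed.

Lemma root_norm v : is_root A v -> '[v, v] = 2.
Proof.
elim=> [i|i u hu IH]; first exact: form_simple_simple.
by rewrite /refl !formlin IH form_simple_simple (formC _ u); ring.
Qed.

(** Induction on [x]: the reflection in [s_i u] is the conjugate by [s_i] of the reflection in
    [u]. *)
Lemma root_reflect x y : is_root A x -> is_root A y -> is_root A (y - '[y, x] *: x).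
Proof.
move=> hx; elim: hx y => [i|i u hu IH] y hy; first by apply: root_refl.
have := root_refl i (IH _ (root_refl i hy)).
congr is_root; rewrite /refl.
set e := simple_root R i; set p := '[y, e]; set q := '[u, e].
have he : '[e, e] = 2 by exact: form_simple_simple.
rewrite !formlin (formC e u) -/p -/q he.
apply/rowP => l; rewrite !mxE; ring.
Qed.

Lemma rootN x : is_root A x -> is_root A (- x).
Proof.
move=> hx; have := root_reflect hx hx; rewrite root_norm //.
by congr is_root; apply/rowP => l; rewrite !mxE; ring.
Qed.

Lemma root_sub x y : is_root A x -> is_root A y -> '[x, y] = 1 -> is_root A (x - y).
Proof. by move=> hx hy e; have := root_reflect hy hx; rewrite e scale1r. Qed.

Lemma root_add x y : is_root A x -> is_root A y -> '[x, y] = - 1 -> is_root A (x + y).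
Proof. by move=> hx hy e; have := root_reflect hy hx; rewrite e scaleN1r opprK. Qed.

Lemma root_neq0 v : is_root A v -> v <> 0.
Proof. move=> /root_norm h e; move: h; rewrite e form0l; lra. Qed.

(* If [s_i v] had both signs, its negative part would be [- e_i] and its
   positive part isotropic, hence supported on components not containing [i]. *)
Lemma refl_sign i v : is_root A v -> nonneg v ->
  nonneg (refl A i v) \/ nonneg (- refl A i v).
Proof.
move=> hv pv; set w := refl A i v.
have hw : is_root A w by apply: root_refl.
have wj j : j != i -> w 0 j = v 0 j.
  by move=> ji; rewrite !mxE (negPf ji) andbF mulr0 subr0.
have [wi|wi] := lerP 0 (w 0 i).
  by left=> j; have [->//|/wj->] := eqVneq j i.
clearbody w; right; pose e := simple_root R i; pose k := - w 0 i; pose u := w + k *: e.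
have uE j : u 0 j = w 0 j + k * (j == i)%:R.
  by rewrite mxE; congr (_ + _); rewrite mxE mxE eqxx.
have wE : w = u - k *: e by rewrite addrK.
clearbody u.
have ui : u 0 i = 0 by rewrite uE eqxx /k mulr1 subrr.
have uj j : j != i -> u 0 j = v 0 j.
  by move=> ji; rewrite uE (negPf ji) mulr0 addr0 wj.
have pu : nonneg u.
  by move=> j; have [->|/uj->//] := eqVneq j i; rewrite ui.
have ue : '[u, e] <= 0.
  rewrite form_simple; apply: sumr_le0 => j _.
  have [->|ji] := eqVneq j i; first by rewrite ui mul0r.
  by apply: mulr_ge0_le0 => //; apply: offdiag_le0.
have k1 : 1 <= k.
  have [z ez] := root_integral hw; move: wi; rewrite /k ez mxE => h.
  by rewrite -intrN (ler_int _ 1); move: h; rewrite ltrz0; lia.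
have h : '[u - k *: e, u - k *: e] = 2 by rewrite -wE root_norm.
have he : '[e, e] = 2 by apply: form_simple_simple.
rewrite !formlin (formC e u) he in h.
have uu0 : 0 <= '[u, u] by apply: hpsd.
(* In [(u, u) - 2k(u, e) + 2k^2 = 2] all terms are nonnegative and the last is at least 2, so
   [(u, u)] vanishes. *)
have ru : rad u by apply: isotropic_rad; nra.
have hD := rad_nonneg_closed ru pu.
case: (root_split (D := fun j => u 0 j != 0) hD hw) => hs.
  by have := hs i; rewrite ui eqxx => /(_ isT) e0; move: wi; rewrite e0 ltxx.
have u0 : u = 0.
  apply/rowP => j; rewrite [RHS]mxE; apply/eqP; case uj0: (u 0 j == 0) => //.
  have := hs j; rewrite uj0 => /(_ isT) wj0.
  have ji : j != i by apply: contraFneq uj0 => ->; rewrite ui.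
  by move: uj0; rewrite uj // -wj // wj0 eqxx.
rewrite wE u0 sub0r opprK; apply: nonnegZ; first by lra.
by move=> j; rewrite mxE; case: (_ && _).
Qed.

Lemma root_sign v : is_root A v -> nonneg v \/ nonneg (- v).
Proof.
elim=> [i|i u hu [IH|IH]].
- by left=> j; rewrite mxE; case: (_ && _).
- exact: refl_sign.
- have := refl_sign i (rootN hu) IH.
  have -> : refl A i (- u) = - refl A i u.
    by rewrite /refl formNl scaleNr opprD opprK.
  by rewrite opprK => -[]; [right|left].
Qed.

Lemma pos_rootE v : pos_root A v <-> is_root A v /\ nonneg v.
Proof. by rewrite /pos_root; split=> -[h /nspan_PiE]. Qed.

Lemma root_pos_or v : is_root A v -> pos_root A v \/ pos_root A (- v).
Proof.
move=> h; case: (root_sign h) => p; [left|right]; apply/pos_rootE; split=> //.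
exact: rootN.
Qed.

(** The pairing is an integer, and semidefiniteness at [x + y] and [x - y] bounds it by 2 in
    absolute value. *)
Lemma form_root_cases x y : is_root A x -> is_root A y ->
  '[x, y] = 0 \/ '[x, y] = 1 \/ '[x, y] = - 1 \/ '[x, y] = 2 \/ '[x, y] = - 2.
Proof.
move=> hx hy; have [m hm] := form_integral (root_integral hx) (root_integral hy).
have h1 := hpsd (x + y); have h2 := hpsd (x - y).
move: h1 h2; rewrite !formlin (formC y x) !root_norm // hm => h1 h2.
have m1 : (m <= 2)%R by rewrite -(ler_int R); lra.
have m2 : (-2 <= m)%R by rewrite -(ler_int R); lra.
have : m = 0 \/ m = 1 \/ m = -1 \/ m = 2 \/ m = -2 by lia.
by case=> [->|[->|[->|[->|->]]]]; auto.
Qed.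

Lemma form2_rad x y : is_root A x -> is_root A y -> '[x, y] = 2 -> rad (x - y).
Proof.
move=> hx hy e; apply: isotropic_rad.
by rewrite !formlin (formC y x) !root_norm // e; lra.
Qed.

Lemma formN2_rad x y : is_root A x -> is_root A y -> '[x, y] = - 2 -> rad (x + y).
Proof.
move=> hx hy e; apply: isotropic_rad.
by rewrite !formlin (formC y x) !root_norm // e; lra.
Qed.

Lemma pos_root_ht v : pos_root A v -> 1 <= ht v.
Proof.
move=> /pos_rootE [hv pv].
have [z e] := root_integral hv.
have h0 := ht_gt0 pv (root_neq0 hv).
have hz : ht v = (\sum_i z 0 i)%:~R.
  by rewrite (rmorph_sum (intmul 1)) /ht e; apply: eq_bigr => i _; rewrite mxE.
by move: h0; rewrite hz ltr0z (ler_int _ 1); lia.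
Qed.

(** Pairing with [x] and [y] settles the cases with nonzero Gram determinant. For [(x, y) = 2] it
    only leaves [p = - q], excluded by [x <> y]; for [-2] it leaves [p = q], excluded by positive
    heights. *)
Lemma pos_root_indep x y (p q : R) : pos_root A x -> pos_root A y -> x <> y ->
  p *: x + q *: y = 0 -> p = 0 /\ q = 0.
Proof.
move=> hx hy nxy e.
have [rx _] := hx; have [ry _] := hy.
have hxx := root_norm rx; have hyy := root_norm ry.
have e1 : p * 2 + q * '[x, y] = 0.
  by rewrite -hxx (formC x y) -!formZl -formDl e form0l.
have e2 : p * '[x, y] + q * 2 = 0.
  by rewrite -hyy -!formZl -formDl e form0l.
have hhx := pos_root_ht hx; have hhy := pos_root_ht hy.
have e3 : p * ht x + q * ht y = 0.
  by rewrite -!htZ -htD e /ht big1 // => i _; rewrite mxE.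
case: (form_root_cases rx ry) => [f|[f|[f|[f|f]]]]; rewrite f in e1 e2;
  try by split; lra.
- have pq : p = - q by lra.
  suff : q = 0 by move=> q0; split; lra.
  have [//|q0] := eqVneq q 0; case: nxy.
  have : q *: (y - x) = 0 by rewrite -e pq; apply/rowP => i; rewrite !mxE; ring.
  by move/eqP; rewrite scaler_eq0 (negPf q0) /= subr_eq0 => /eqP.
- have pq : p = q by lra.
  by suff : q = 0 by [move=> q0; split; lra]; nra.
Qed.

(** * Linear relations between roots *)

Lemma lspan_pairE a b v :
  lspan (pair_set a b) v <-> exists p q : R, v = p *: a + q *: b.
Proof.
split=> [[s [hs ->]]|[p [q ->]]].
  elim: s hs => [|r s IH] hs.
    by exists 0, 0; rewrite big_nil !scale0r addr0.
  have [|p [q e]] := IH; first by move=> r' hr; apply: hs; rewrite in_cons hr orbT.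
  rewrite big_cons e; case: (hs r (mem_head _ _)) => ->.
    by exists (r.1 + p), q; rewrite scalerDl addrA.
  by exists p, (r.1 + q); rewrite scalerDl addrCA.
exists [:: (p, a); (q, b)]; split=> [r|]; last by rewrite !big_cons big_nil addr0.
by rewrite !inE => /orP[] /eqP ->; [left|right].
Qed.

Lemma nspan_pairE a b v :
  nspan (pair_set a b) v <-> exists p q : R, [/\ 0 <= p, 0 <= q & v = p *: a + q *: b].
Proof.
split=> [[s [hs ->]]|[p [q [hp hq ->]]]].
  elim: s hs => [|r s IH] hs.
    by exists 0, 0; rewrite big_nil !scale0r addr0.
  have [|p [q [hp hq e]]] := IH; first by move=> r' hr; apply: hs; rewrite in_cons hr orbT.
  rewrite big_cons e; have [hr] := hs r (mem_head _ _); case=> ->.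
    by exists (r.1 + p), q; rewrite scalerDl addrA addr_ge0.
  by exists p, (r.1 + q); rewrite scalerDl addrCA addr_ge0.
exists [:: (p, a); (q, b)]; split=> [r|]; last by rewrite !big_cons big_nil addr0.
by rewrite !inE => /orP[] /eqP ->; split=> //; [left|right].
Qed.

Lemma hexagon a b k (p q : R) : is_root A a -> is_root A b -> '[a, b] = - 1 ->
  rad k -> is_root A (p *: a + q *: b + k) ->
  [\/ p = 1 /\ q = 0, p = 0 /\ q = 1 | p = -1 /\ q = -1] \/
  [\/ p = -1 /\ q = 0, p = 0 /\ q = -1 | p = 1 /\ q = 1].
Proof.
move=> ra rb ab rk rx; have nx := root_norm rx.
have xa := form_root_cases rx ra; have xb := form_root_cases rx rb.
have k_r := rad_r rk.
rewrite !formlin !rk !k_r !root_norm // (formC b a) ab in nx.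
rewrite !formlin !rk !root_norm // (formC b a) ab in xa.
rewrite !formlin !rk !root_norm // ab in xb.
apply: hexagon_coord; last by lra.
- by have -> : 2 * p - q = p * 2 + q * - 1 + 0 by ring.
- by have -> : 2 * q - p = p * - 1 + q * 2 + 0 by ring.
Qed.

Lemma pos_root_uncomb x y (p q p' q' : R) : pos_root A x -> pos_root A y -> x <> y ->
  p *: x + q *: y = p' *: x + q' *: y -> p = p' /\ q = q'.
Proof.
move=> hx hy nxy e.
have [|h1 h2] := pos_root_indep (p := p - p') (q := q - q') hx hy nxy; last by split; lra.
by rewrite !scalerBl addrACA -opprD e subrr.
Qed.

(** The fundamental vectors act as a base of the plane, so [(u, w)] is 0, -1 or -2: otherwise
    [u - w] or [u - 2w] would be a root of mixed sign. The three types A1 x A1, A2 and A1~ leave for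
    [c] nothing, [u + w], and [u] or [w] plus a multiple of [u + w]. *)
Lemma fundamental_below Y u w c :
  two_dim_linear_subset (pos_root A) Y -> fundamental_vectors Y u w ->
  Y c -> c <> u -> c <> w -> nonneg (c - u) /\ nonneg (c - w).
Proof.
move=> [a [b [Xa [Xb [ab YE]]]]] [Yu [Yw [Ysub _]]] Yc cu cw.
have [Xu /lspan_pairE[ua [ub uE]]] := (YE u).1 Yu.
have [Xw /lspan_pairE[wa [wb wE]]] := (YE w).1 Yw.
have [Xc _] := (YE c).1 Yc.
have [ru pu] := (pos_rootE u).1 Xu; have [rw pw] := (pos_rootE w).1 Xw.
have [rc _] := (pos_rootE c).1 Xc.
have Yin z (p q : R) : z = p *: u + q *: w -> pos_root A z -> Y z.
  move=> -> hz; apply/YE; split=> //; apply/lspan_pairE.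
  exists (p * ua + q * wa), (p * ub + q * wb); rewrite uE wE.
  by apply/rowP => i; rewrite !mxE; ring.
have uw : u <> w.
  have Ya : Y a by apply/YE; split=> //; apply/lspan_pairE; exists 1, 0; rewrite scale1r scale0r addr0.
  have Yb : Y b by apply/YE; split=> //; apply/lspan_pairE; exists 0, 1; rewrite scale1r scale0r add0r.
  move=> euw; have /nspan_pairE[p [q [_ _ aE]]] := Ysub _ Ya.
  have /nspan_pairE[p' [q' [_ _ bE]]] := Ysub _ Yb.
  have [|h1 h2] := ab (p' + q') (- (p + q)).
    by rewrite aE bE euw; apply/rowP => i; rewrite !mxE; ring.
  have pq : p + q = 0 by lra.
  by apply: (root_neq0 Xa.1); rewrite aE euw -scalerDl pq scale0r.
have coef z (p q : R) : z = p *: u + q *: w -> pos_root A z -> 0 <= p /\ 0 <= q.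
  move=> zE hz; have /nspan_pairE[p' [q' [h1 h2 zE']]] := Ysub _ (Yin _ _ _ zE hz).
  by have [-> ->] := pos_root_uncomb Xu Xw uw (etrans (esym zE) zE').
have same_sign z (p q : R) : z = p *: u + q *: w -> is_root A z ->
    0 <= p /\ 0 <= q \/ p <= 0 /\ q <= 0.
  move=> zE rz; case: (root_pos_or rz) => hz; [left; exact: coef zE hz|right].
  have [|h1 h2] := coef (- z) (- p) (- q) _ hz; last by split; lra.
  by rewrite zE; apply/rowP => i; rewrite !mxE; ring.
have /nspan_pairE[x [y [x0 y0 cE]]] := Ysub _ Yc.
have nc := root_norm rc; have hcu := form_root_cases rc ru; have hcw := form_root_cases rc rw.
have nu := root_norm ru; have nw := root_norm rw.
rewrite cE !formlin nu nw (formC w u) in nc.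
rewrite cE !formlin nu (formC w u) in hcu.
rewrite cE !formlin nw in hcw.
have cu' : ~ (x = 1 /\ y = 0) by move=> [ex ey]; apply: cu; rewrite cE ex ey scale1r scale0r addr0.
have cw' : ~ (x = 0 /\ y = 1) by move=> [ex ey]; apply: cw; rewrite cE ex ey scale1r scale0r add0r.
case: (form_root_cases ru rw) => [f|[f|[f|[f|f]]]]; rewrite f in nc hcu hcw.
- exfalso; have := @square_coord R x y; rewrite /= => sq.
  have : x = 0 \/ y = 0.
    apply: sq; last by lra.
    + by have -> : 2 * x = x * 2 + y * 0 by ring.
    + by have -> : 2 * y = x * 0 + y * 2 by ring.
  case=> h; rewrite h in nc cu' cw'.
    by apply: cw'; split=> //; apply: sqr_eq1_pos => //; lra.
  by apply: cu'; split=> //; apply: sqr_eq1_pos => //; lra.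
- have /same_sign := root_sub ru rw f; move=> /(_ 1 (-1)); rewrite scale1r scaleN1r => /(_ erefl) h.
  by exfalso; apply: (@one_le0F R); lra.
- have x1 : x = 1 /\ y = 1.
    have := @hexagon_coord R x y; rewrite /= => hx.
    have {hx} : [\/ x = 1 /\ y = 0, x = 0 /\ y = 1 | x = -1 /\ y = -1] \/
      [\/ x = -1 /\ y = 0, x = 0 /\ y = -1 | x = 1 /\ y = 1].
      apply: hx; last by lra.
      + by have -> : 2 * x - y = x * 2 + y * -1 by ring.
      + by have -> : 2 * y - x = x * -1 + y * 2 by ring.
    by case=> -[] // [ex ey]; exfalso; apply: (@one_le0F R); lra.
  by rewrite cE x1.1 x1.2 !scale1r addrK addrAC subrr add0r.
- have h := root_reflect rw ru; rewrite f in h.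
  have := same_sign _ 1 (-2) _ h; rewrite scale1r scaleNr => /(_ erefl) h'.
  by exfalso; apply: (@one_le0F R); lra.
(* Type A1~: the norm of [c] only sees [x - y], and [u + w] is isotropic. *)
- have xy : (x - y) ^+ 2 = 1 by lra.
  have puw : nonneg (u + w) by apply: nonnegD.
  have xy' : x = y + 1 \/ y = x + 1.
    have : (x - y - 1) * (x - y + 1) = 0 by lra.
    by move/eqP; rewrite mulf_eq0 => /orP[] /eqP h; [left|right]; lra.
  case: xy' => h.
    have rz := root_reflect ru rc.
    have cu2 : '[c, u] = 2 by rewrite cE !formlin nu (formC w u) f h; lra.
    (* [y] is only known to be real. The reflection of [c] in [u] has coordinates [y - 1] and [y],
       and sign coherence excludes [0 < y < 1]. *)
    have y1 : 1 <= y.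
      have := same_sign _ (y - 1) y _ rz; rewrite cu2 cE h => h'.
      have {h'} : 0 <= y - 1 /\ 0 <= y \/ y - 1 <= 0 /\ y <= 0.
        by apply: h'; apply/rowP => i; rewrite !mxE; ring.
      case; first by lra.
      by move=> [_ yle]; exfalso; apply: cu'; split; lra.
    split.
      have -> : c - u = y *: (u + w) by rewrite cE h; apply/rowP => i; rewrite !mxE; ring.
      exact: nonnegZ.
    have -> : c - w = (y + 1) *: u + (y - 1) *: w.
      by rewrite cE h; apply/rowP => i; rewrite !mxE; ring.
    by apply: nonnegD; apply: nonnegZ => //; lra.
  have rz := root_reflect rw rc.
  have cw2 : '[c, w] = 2 by rewrite cE !formlin nw f h; lra.
  have y1 : 1 <= x.
    have := same_sign _ x (x - 1) _ rz; rewrite cw2 cE h => h'.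
    have {h'} : 0 <= x /\ 0 <= x - 1 \/ x <= 0 /\ x - 1 <= 0.
      by apply: h'; apply/rowP => i; rewrite !mxE; ring.
    case; first by lra.
    by move=> [yle _]; exfalso; apply: cw'; split; lra.
  split.
    have -> : c - u = (x - 1) *: u + (x + 1) *: w.
      by rewrite cE h; apply/rowP => i; rewrite !mxE; ring.
    by apply: nonnegD; apply: nonnegZ => //; lra.
  have -> : c - w = x *: (u + w) by rewrite cE h; apply/rowP => i; rewrite !mxE; ring.
  exact: nonnegZ.
Qed.

(** * Isotropic differences of roots *)

Lemma root_pair_split a b (D : pred 'I_n) :
  (forall i j, D i -> ~~ D j -> A i j = 0) -> is_root A a -> is_root A b -> '[a, b] <> 0 ->
  (forall i, ~~ D i -> a 0 i = 0 /\ b 0 i = 0) \/ (forall i, D i -> a 0 i = 0 /\ b 0 i = 0).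
Proof.
move=> hD ra rb ab; case: (root_split hD ra) => ha; case: (root_split hD rb) => hb.
- by left=> i Di; rewrite ha ?hb.
- by case: ab; apply: form_split hD ha hb.
- by case: ab; rewrite formC; apply: form_split hD hb ha.
- by right=> i Di; rewrite ha ?hb.
Qed.

Lemma rad_diff_form a b : is_root A a -> rad (b - a) -> '[a, b] = 2.
Proof.
move=> ra h; have := h a; rewrite formDl formNl root_norm // (formC b a); lra.
Qed.

(** With [k = b - a], the vector [|k| + k] is radical and nonnegative, so the set where [k] is
    positive is a union of components. As [(a, b) = 2], both roots live entirely inside or entirely
    outside this set. *)
Lemma rad_diff_sign a b : is_root A a -> is_root A b -> rad (b - a) ->
  nonneg (b - a) \/ nonneg (a - b).
Proof.
move=> ra rb rk; set k := b - a.
pose w : V := map_mx Num.norm k + k.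
have rw : rad w by apply: radD => //; apply: rad_abs.
have wE i : w 0 i = `|k 0 i| + k 0 i by rewrite mxE mxE.
have pw : nonneg w by move=> i; rewrite wE; have := ler_norm (- k 0 i); rewrite normrN; lra.
have ab : '[a, b] <> 0 by rewrite (rad_diff_form ra rk); lra.
have kE i : k 0 i = b 0 i - a 0 i by rewrite !mxE.
case: (root_pair_split (rad_nonneg_closed rw pw) ra rb ab) => h; [left|right] => i.
- case wi: (w 0 i != 0); last first.
    by have [ea eb] := h i (negbT wi); rewrite kE ea eb subrr.
  case: (lerP 0 (k 0 i)) => // ki; move: wi; rewrite wE ltr0_norm // addNr eqxx //.
- have -> : (a - b) 0 i = - k 0 i by rewrite !mxE; ring.
  case wi: (w 0 i != 0).
    by have [ea eb] := h i wi; rewrite kE ea eb subrr oppr0.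
  by move/negbFE/eqP: wi; rewrite wE; have := normr_ge0 (k 0 i); lra.
Qed.

(* The absolute value of an isotropic vector is isotropic, so its support is a
   union of components: two isotropic differences on one component are proportional. *)
Lemma rad_diff_dep a b c : is_root A a -> is_root A b -> is_root A c ->
  rad (b - a) -> rad (c - a) ->
  exists k, [/\ rad k, nonneg k, exists p : R, b = a + p *: k & exists q : R, c = a + q *: k].
Proof.
move=> ra rb rc rba rca.
have main u : is_root A u -> rad (u - a) ->
    (forall v, v = b \/ v = c -> exists t : R, v - a = t *: (u - a)) ->
    exists k, [/\ rad k, nonneg k, exists p : R, b = a + p *: k & exists q : R, c = a + q *: k].
  move=> ru rua h; have [p ep] := h b (or_introl erefl); have [q eq] := h c (or_intror erefl).
  case: (rad_diff_sign ra ru rua) => hs.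
    by exists (u - a); split=> //; [exists p|exists q]; rewrite -?ep -?eq addrC subrK.
  exists (a - u); split=> //; first by rewrite -opprB; apply: radN.
    by exists (- p); rewrite -opprB scalerN scaleNr opprK -ep addrC subrK.
  by exists (- q); rewrite -opprB scalerN scaleNr opprK -eq addrC subrK.
have [eb|/eqP nb] := pselect (b = a).
  apply: (main c) => // v [->|->]; last by exists 1; rewrite scale1r.
  by exists 0; rewrite eb subrr scale0r.
have [i0 hi0] : exists i, (b - a) 0 i != 0.
  apply/existsP; apply: contraNT nb; rewrite negb_exists => /forallP h.
  by rewrite -subr_eq0; apply/eqP/rowP => i; have := h i; rewrite negbK [RHS]mxE => /eqP.
set k1 := b - a in hi0 rba *; set k2 := c - a in rca *.
(* Chosen to make [k] vanish at [i0], where [k1] does not; the support of [|k|] thus misses a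
   coordinate where [a] and [b] differ. *)
pose t := k2 0 i0 / k1 0 i0; pose k : V := k2 - t *: k1.
have rk : rad k by apply: radD => //; apply: radN; apply: radZ.
pose w : V := map_mx Num.norm k.
have rw : rad w by apply: rad_abs.
have pw : nonneg w by move=> i; rewrite mxE.
have wE i : (w 0 i != 0) = (k 0 i != 0) by rewrite mxE normr_eq0.
have ki0 : k 0 i0 = 0.
  have -> : k 0 i0 = k2 0 i0 - t * k1 0 i0 by rewrite mxE; congr (_ + _); rewrite mxE mxE.
  by rewrite /t divfK // subrr.
have hw := rad_nonneg_closed rw pw.
have ab : '[a, b] <> 0 by rewrite (rad_diff_form ra rba); lra.
have ac : '[a, c] <> 0 by rewrite (rad_diff_form ra rca); lra.
have k0 : k = 0.
  case: (root_pair_split hw ra rb ab) => h1.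
    have [|e1 e2] := h1 i0; first by rewrite wE ki0 eqxx.
    by move: hi0; rewrite !mxE e1 e2 subrr eqxx.
  apply/rowP => i; rewrite [RHS]mxE; apply/eqP; case kin: (k 0 i == 0) => //.
  case: (root_pair_split hw ra rc ac) => h2.
    have ai0 : a 0 i0 = 0 by have [|] := h2 i0; rewrite ?wE ?ki0 ?eqxx.
    have [ea _] : a 0 i = 0 /\ b 0 i = 0 by apply: h1; rewrite wE kin.
    suff : a = 0 by move=> /(root_neq0 ra).
    apply/rowP => j; rewrite [RHS]mxE; case wj: (w 0 j != 0); first by have [] := h1 j wj.
    by have [] := h2 j (negbT wj).
  have [e1 e2] : a 0 i = 0 /\ b 0 i = 0 by apply: h1; rewrite wE kin.
  have [e3 e4] : a 0 i = 0 /\ c 0 i = 0 by apply: h2; rewrite wE kin.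
  move/negP: kin; case; apply/eqP.
  have -> : k 0 i = k2 0 i - t * k1 0 i by rewrite mxE; congr (_ + _); rewrite mxE mxE.
  by rewrite /k1 /k2 !mxE e1 e2 e4; ring.
apply: (main b) => // v [->|->]; first by exists 1; rewrite scale1r.
by exists t; apply/eqP; rewrite -subr_eq0 -/k1 -/k2 -/k k0.
Qed.

(** * Cleanness in a plane and in the definite case *)

Definition linear_in (g : V -> R) := forall (p : R) u v, g (p *: u + v) = p * g u + g v.

Lemma linear_in0 (g : V -> R) : linear_in g -> g 0 = 0.
Proof. by move=> hg; have := hg 1 0 0; rewrite scale1r addr0 mul1r; lra. Qed.

Lemma nspan_linear_le0 (B : V -> Prop) (g : V -> R) v : linear_in g ->
  nspan B v -> v <> 0 -> g v <= 0 -> exists2 b, B b & g b <= 0.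
Proof.
move=> hg [s [hs ve]] vn gv.
have [h|h] := pselect (exists2 b, B b & g b <= 0); first by [].
have gB b : B b -> 0 < g b.
  by move=> hb; rewrite ltNge; apply/negP => gb; apply: h; exists b.
suff [//|] : v = 0 \/ 0 < g v by rewrite ltNge gv.
rewrite ve; elim: s hs {ve} => [|r s IH] hs; first by left; rewrite big_nil.
have [r0 Br] := hs r (mem_head _ _).
have {}IH := IH (fun q hq => hs q (mem_behead (s := r :: s) hq)).
rewrite big_cons hg; have := gB _ Br => gr.
move: r0; rewrite le_eqVlt => /orP[/eqP<-|r0].
  by rewrite scale0r !mul0r !add0r.
right; apply: ltr_pwDl; first exact: mulr_gt0.
by case: IH => [->|/ltW //]; rewrite linear_in0.
Qed.

(* In a plane, the slopes of [B] and of its complement in [Z] span two intervals containing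
   the slope of [v]; an endpoint of one of them then lies in the other. *)
Lemma planar_clean (Z : V -> Prop) e f (h g : V -> R) : linear_in h -> linear_in g ->
  (forall x, Z x -> 0 < h x /\ x = h x *: e + g x *: f) -> clean Z.
Proof.
move=> hh hg hZ B BZ [[_ cB] [_ cC]] v vB vC; apply/eqP/negPn/negP => /eqP vn.
set C := setminus Z B in cC vC.
have CZ x : C x -> Z x by case.
have nd x : B x -> C x -> False by move=> ? [].
have between x y z : Z x -> Z y -> Z z -> g x / h x <= g y / h y -> g y / h y <= g z / h z ->
    nspan (pair_set x z) y.
  move=> /hZ[x0 ex] /hZ[y0 ey] /hZ[z0 ez] h1 h2; apply/nspan_pairE.
  have [e3|n3] := eqVneq (g x / h x) (g z / h z).
    have e4 : g x / h x = g y / h y by apply/le_anti; rewrite h1 e3 h2.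
    exists (h y / h x), 0; split=> //; first by rewrite divr_ge0 ?ltW.
    rewrite scale0r addr0.
    suff : h y *: e + g y *: f = (h y / h x) *: (h x *: e + g x *: f) by rewrite -ey -ex.
    rewrite scalerDr !scalerA divfK ?gt_eqF //; congr (_ + _ *: _).
    by rewrite mulrAC -mulrA e4 mulrC divfK ?gt_eqF.
  have d0 : 0 < g z / h z - g x / h x.
    by rewrite subr_gt0 lt_neqAle n3 (le_trans h1 h2).
  exists (h y / h x * ((g z / h z - g y / h y) / (g z / h z - g x / h x))).
  exists (h y / h z * ((g y / h y - g x / h x) / (g z / h z - g x / h x))).
  have hyx := divr_ge0 (ltW y0) (ltW x0); have hyz := divr_ge0 (ltW y0) (ltW z0).
  have dzy : 0 <= g z / h z - g y / h y by rewrite subr_ge0.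
  have dyx : 0 <= g y / h y - g x / h x by rewrite subr_ge0.
  split; [exact: mulr_ge0 hyx (divr_ge0 dzy (ltW d0))
         |exact: mulr_ge0 hyz (divr_ge0 dyx (ltW d0))|].
  set p := h y / h x * _; set q := h y / h z * _.
  suff : h y *: e + g y *: f = p *: (h x *: e + g x *: f) + q *: (h z *: e + g z *: f).
    by rewrite -ey -ex -ez.
  have nx : h x != 0 by rewrite gt_eqF.
  have nz : h z != 0 by rewrite gt_eqF.
  have d1 : g z * h x + - g x * h z != 0.
    have -> : g z * h x + - g x * h z = (g z / h z - g x / h x) * (h x * h z).
      by field; rewrite nx nz.
    by rewrite !mulf_neq0 // gt_eqF.
  rewrite !scalerDr !scalerA addrACA -!scalerDl.
  by congr (_ *: _ + _ *: _); rewrite /p /q; field; rewrite ?nx ?nz ?d1 // gt_eqF.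
have hv0 : 0 < h v.
  rewrite ltNge; apply/negP => hv; have [b Bb] := nspan_linear_le0 hh vB vn hv.
  by rewrite leNgt (hZ b (BZ _ Bb)).1.
(* The sign of [g1 x] compares the slope of [x] with that of [v]. Both [g1] and [g2] vanish at [v],
   so [B] and [C] each have elements on either side of [v]. *)
pose g1 x := g x * h v - h x * g v; pose g2 x := - g1 x.
have hg1 : linear_in g1 by move=> p x y; rewrite /g1 hh hg; ring.
have hg2 : linear_in g2 by move=> p x y; rewrite /g2 hg1; ring.
have g10 : g1 v <= 0 by rewrite /g1; lra.
have g20 : g2 v <= 0 by rewrite /g2 /g1; lra.
have [b1 Bb1 hb1] := nspan_linear_le0 hg1 vB vn g10.
have [b2 Bb2 hb2] := nspan_linear_le0 hg2 vB vn g20.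
have [c1 Cc1 hc1] := nspan_linear_le0 hg1 vC vn g10.
have [c2 Cc2 hc2] := nspan_linear_le0 hg2 vC vn g20.
have lo x : Z x -> g1 x <= 0 -> g x / h x <= g v / h v.
  move=> /hZ[x0 _] gx; rewrite ler_pdivrMr // mulrAC ler_pdivlMr //.
  by rewrite /g1 in gx; lra.
have hi x : Z x -> g2 x <= 0 -> g v / h v <= g x / h x.
  move=> /hZ[x0 _] gx; rewrite ler_pdivrMr // mulrAC ler_pdivlMr //.
  by rewrite /g2 /g1 in gx; lra.
have Zb1 := BZ _ Bb1; have Zb2 := BZ _ Bb2; have Zc1 := CZ _ Cc1; have Zc2 := CZ _ Cc2.
have [bc|cb] := lerP (g b1 / h b1) (g c1 / h c1).
  apply: (nd c1 _ Cc1); apply: (cB b1 b2 c1 Bb1 Bb2 _ Zc1); apply: between => //.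
  exact: le_trans (lo _ Zc1 hc1) (hi _ Zb2 hb2).
apply: (nd b1 Bb1); apply: (cC c1 c2 b1 Cc1 Cc2 _ Zb1); apply: between => //.
  exact: ltW.
exact: le_trans (lo _ Zb1 hb1) (hi _ Zc2 hc2).
Qed.

(** * Integer relations and the descent *)

Lemma nspan_positive (B : V -> Prop) v : nspan B v -> exists l : seq (R * V),
  (forall p, p \in l -> 0 < p.1 /\ B p.2) /\ v = \sum_(p <- l) p.1 *: p.2.
Proof.
move=> [s [hs ->]]; exists [seq p <- s | 0 < p.1]; split.
  by move=> p; rewrite mem_filter => /andP[p0 /hs[_ hp]].
rewrite big_filter [RHS]big_mkcond /= !big_seq; apply: eq_bigr => p /hs[p0 _].
by case: ltP => // p0'; have -> : p.1 = 0 by [apply/le_anti; rewrite p0 p0'|]; rewrite scale0r.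
Qed.

(** The two expressions of [v] form one relation, the vectors of [C] taken with a minus sign. A
    positive integer relation between the same vectors exists, and its coefficients become
    multiplicities in the lists. *)
Lemma int_relation_lists (B C : V -> Prop) v :
  (forall x, B x -> integral x) -> (forall x, C x -> integral x) ->
  nspan B v -> nspan C v -> v <> 0 ->
  exists s r : seq V, [/\ forall x, x \in s -> B x, forall x, x \in r -> C x,
    s <> [::] & \sum_(x <- s) x = \sum_(x <- r) x].
Proof.
move=> iB iC /nspan_positive[lB [hB vB]] /nspan_positive[lC [hC vC]] vn.
pose L := [seq (true, p) | p <- lB] ++ [seq (false, p) | p <- lC].
pose k := size L; pose d0 : bool * (R * V) := (true, (0, 0)).
pose sg (p : bool * (R * V)) : V := if p.1 then p.2.2 else - p.2.2.
pose X (l : 'I_k) := nth d0 L l.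
have LP p : p \in L -> 0 < p.2.1 /\ (if p.1 then B p.2.2 else C p.2.2).
  rewrite mem_cat => /orP[] /mapP[q hq ->] /=; [exact: hB|exact: hC].
have XL l : X l \in L by apply: mem_nth.
have /fin_all_exists[z hz] (l : 'I_k) : exists z : 'rV[int]_n, sg (X l) = map_mx intr z.
  have [_] := LP _ (XL l); rewrite /sg; case: (X l).1 => [/iB|/iC] [z ez].
    by exists z.
  by exists (- z); rewrite ez; apply/rowP => j; rewrite !mxE intrN.
pose U : 'M[int]_(k, n) := \matrix_(l, j) z l 0 j.
pose x : 'rV[R]_k := \row_l (X l).2.1.
have sumX (F : bool * (R * V) -> V) : \sum_(l < k) F (X l) = \sum_(p <- L) F p.
  by rewrite (big_nth d0) big_mkord.
have [] := @positive_int_relation R k n U x.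
- by move=> l; rewrite mxE; have [] := LP _ (XL l).
- have -> : x *m map_mx intr U = \sum_(l < k) (X l).2.1 *: sg (X l).
    apply/rowP => j; rewrite mxE summxE; apply: eq_bigr => l _.
    by rewrite hz !mxE.
  rewrite (sumX (fun p => p.2.1 *: sg p)) big_cat !big_map /sg /= -vB.
  under eq_bigr do rewrite scalerN.
  by rewrite sumrN -vC subrr.
move=> m [m0 mU].
pose cp (l : 'I_k) := absz (m 0 l).
have cpE l : (cp l)%:R = (m 0 l)%:~R :> R by rewrite /cp natr_absz gtr0_norm.
have rel : \sum_(l < k) sg (X l) *+ cp l = 0.
  have := congr1 (map_mx (intr : int -> R)) mU; rewrite map_mx0 => e.
  rewrite -[RHS]e; apply/rowP => j; rewrite summxE map_mxM mxE; apply: eq_bigr => l _.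
  by rewrite -scaler_nat cpE mxE hz !mxE.
pose lst (b : bool) := flatten [seq nseq (cp l) (X l).2.2 | l <- enum 'I_k & (X l).1 == b].
have lstP (b : bool) y : y \in lst b -> if b then B y else C y.
  move=> /flatten_mapP[l]; rewrite mem_filter => /andP[/eqP <- _].
  by move=> /nseqP[-> _]; have [] := LP _ (XL l).
have lst_sum (b : bool) : \sum_(y <- lst b) y = \sum_(l < k | (X l).1 == b) (X l).2.2 *+ cp l.
  rewrite big_flatten big_map big_filter big_enum_cond /=; apply: eq_bigr => l _.
  by rewrite big_nseq iter_addr_0.
exists (lst true), (lst false); split.
- by move=> y /lstP.
- by move=> y /lstP.
- have lB0 : (0 < size lB)%N.
    by case: lB vB {hB L k X LP XL z hz U x sumX m m0 mU cp cpE rel lst lstP lst_sum} => //; rewrite big_nil.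
  have k0 : (0 < k)%N by rewrite /k size_cat size_map ltn_addr.
  pose i0 := Ordinal k0.
  have X0 : (X i0).1 = true.
    by rewrite /X /= nth_cat size_map lB0 (nth_map (0, 0)).
  move=> e; have : (X i0).2.2 \in lst true.
    apply/flatten_mapP; exists i0; first by rewrite mem_filter X0 mem_enum.
    by rewrite mem_nseq eqxx andbT /cp absz_gt0 gt_eqF.
  by rewrite e.
- rewrite !lst_sum; move/eqP: rel; rewrite (bigID (fun l => (X l).1 == true)) /=.
  rewrite addr_eq0 => /eqP e.
  rewrite (eq_bigr (fun l => sg (X l) *+ cp l)); last by move=> l /eqP h; rewrite /sg h.
  rewrite e -sumrN; apply: eq_big => l; first by case: (X l).1.
  by rewrite /sg; case: (X l).1 => // _; rewrite mulNrn opprK.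
Qed.

Lemma form_sumr s w : '[w, \sum_(x <- s) x] = \sum_(x <- s) '[w, x].
Proof. by rewrite formC form_suml; apply: eq_bigr => x _; rewrite formC. Qed.

Lemma sum_nonneg s : (forall x, x \in s -> nonneg x) -> nonneg (\sum_(x <- s) x).
Proof.
elim: s => [|x s IH] hs; first by rewrite big_nil; apply: nonneg0.
rewrite big_cons; apply: nonnegD; first by apply: hs; rewrite mem_head.
by apply: IH => y hy; apply: hs; rewrite in_cons hy orbT.
Qed.

Lemma sum_le0_seq (F : V -> R) s : (forall x, x \in s -> F x <= 0) ->
  \sum_(x <- s) F x = 0 -> forall x, x \in s -> F x = 0.
Proof.
elim: s => [|y s IH] hs; first by move=> _ x; rewrite in_nil.
have hy := hs y (mem_head _ _).
have hs' x : x \in s -> F x <= 0 by move=> xs; apply: hs; rewrite in_cons xs orbT.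
have h : \sum_(x <- s) F x <= 0.
  by rewrite big_seq; apply: sumr_le0 => x /hs'.
rewrite big_cons => e x; rewrite in_cons => /orP[/eqP->|]; first by lra.
by apply: IH => //; lra.
Qed.

Lemma ht_sum_gt0 s : (forall x, x \in s -> pos_root A x) -> s <> [::] ->
  0 < ht (\sum_(x <- s) x).
Proof.
case: s => [//|x s] hs _; rewrite big_cons htD ltr_wpDr //; last first.
  by apply: lt_le_trans (pos_root_ht (hs _ (mem_head _ _))).
apply: ht_ge0; apply: sum_nonneg => y hy.
by have /pos_rootE[] := hs y (mem_behead (s := x :: s) hy).
Qed.

(* Each step replaces a pair [b, c] with [(b, c) = 1] by the root [b - c] or
   [c - b] on the appropriate side, or absorbs a pair with [(b, c) = 2] into the
   isotropic term; the height of the common sum drops. *)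
Lemma relation_descent (B C T : V -> Prop) :
  (forall x, B x -> pos_root A x) -> (forall x, C x -> pos_root A x) ->
  (forall k, T k -> rad k /\ nonneg k) ->
  (forall k b c, T k -> B b -> C c -> '[b, c] = 2 -> T (k + (b - c)) /\ 0 < ht (b - c)) ->
  (forall b c, B b -> C c -> '[b, c] = 1 -> B (b - c) \/ C (c - b)) ->
  forall (s r : seq V) k, (forall x, x \in s -> B x) -> (forall x, x \in r -> C x) ->
    T k -> r <> [::] -> \sum_(x <- s) x + k = \sum_(x <- r) x ->
  exists (s' r' : seq V) k', [/\ forall x, x \in s' -> B x, forall x, x \in r' -> C x,
    T k', r' <> [::] & \sum_(x <- s') x + k' = \sum_(x <- r') x] /\
    (rad (\sum_(x <- r') x) /\ forall b c, b \in s' -> c \in r' -> '[b, c] = 0).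
Proof.
move=> Bp Cp Trad T2 step s r k hs hr Tk rn e.
(* Each replacement lowers the height of the sum over [r] by the height of [b] or of [c], hence by
   at least 1. *)
have [N hN] : exists N : nat, ht (\sum_(x <- r) x) < N%:R.
  exists (Num.bound (ht (\sum_(x <- r) x))).
  by apply: archi_boundP; apply: ltW; apply: ht_sum_gt0 => // x /hr/Cp.
elim: N s r k hN hs hr Tk rn e => [|N IH] s r k hN hs hr Tk rn e.
  have := ht_sum_gt0 (fun x hx => Cp x (hr x hx)) rn; move=> ?; exfalso; apply: (@one_le0F R); lra.
have [rk pk] := Trad _ Tk.
have [h|h] := pselect (forall b c, b \in s -> c \in r -> '[b, c] <= 0).
  exists s, r, k; split=> //; set v := \sum_(x <- r) x.
  have vle b : b \in s -> '[b, v] <= 0.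
    by move=> bs; rewrite form_sumr big_seq; apply: sumr_le0 => c; apply: h.
  have rv : rad v.
    (* Only one factor of [(v, v)] is expanded over [s]: the other stays a sum over [r], so that
       only mixed pairs occur. *)
    have ve : v = \sum_(x <- s) x + k by rewrite e.
    apply: isotropic_rad; rewrite {1}ve formDl rk addr0 form_suml big_seq.
    by apply: sumr_le0 => b; apply: vle.
  split=> // b c bs; apply: sum_le0_seq; first by move=> c' hc'; apply: h.
  by rewrite -form_sumr rad_r.
have [b [c [bs cr bc]]] : exists b c, [/\ b \in s, c \in r & 0 < '[b, c]].
  apply/not_existsP => h1; apply: h => b c bs cr; rewrite leNgt; apply/negP => h2.
  by apply: (h1 b); exists c.
have Bb := hs _ bs; have Cc := hr _ cr; have Xb := Bp _ Bb; have Xc := Cp _ Cc.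
have es : \sum_(x <- s) x = b + \sum_(x <- rem b s) x by rewrite (big_rem b).
have er : \sum_(x <- r) x = c + \sum_(x <- rem c r) x by rewrite (big_rem c).
have hb1 := pos_root_ht Xb; have hc1 := pos_root_ht Xc.
have hs' x : x \in rem b s -> B x by move/mem_rem/hs.
have hr' x : x \in rem c r -> C x by move/mem_rem/hr.
have hB x : B x -> 1 <= ht x by move/Bp; apply: pos_root_ht.
have hC x : C x -> 1 <= ht x by move/Cp; apply: pos_root_ht.
have hsum0 (t0 : seq V) : (forall x : V, x \in t0 -> B x) -> 0 <= ht (\sum_(x <- t0) x).
  by move=> h0; apply: ht_ge0; apply: sum_nonneg => x /h0/Bp/pos_rootE[].
have hk0 := ht_ge0 pk.
have rn0 (t0 : seq V) : 0 < ht (\sum_(x <- t0) x) -> t0 <> [::].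
  by move=> + t00; rewrite t00 big_nil /ht big1 ?ltxx // => i _; rewrite mxE.
move: e hN; rewrite es er htD -natr1 => e hN.
case: (form_root_cases (Bp _ Bb).1 (Cp _ Cc).1) => [f|[f|[f|[f|f]]]];
  try by exfalso; apply: (@one_le0F R); lra.
- case: (step _ _ Bb Cc f) => hd.
    have e' : \sum_(x <- (b - c) :: rem b s) x + k = \sum_(x <- rem c r) x.
      rewrite big_cons; apply: (addrI c); rewrite -e.
      by apply/rowP => i; rewrite !mxE; ring.
    apply: (IH _ _ k _ _ hr' Tk _ e'); first by lra.
      by move=> x; rewrite in_cons => /orP[/eqP->|/hs'].
    apply: rn0; rewrite -e' big_cons !htD; have := hB _ hd; have := hsum0 _ hs'.
    by rewrite htD; lra.
  have e' : \sum_(x <- rem b s) x + k = \sum_(x <- (c - b) :: rem c r) x.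
    rewrite big_cons; apply: (addrI b); rewrite addrA e.
    by apply/rowP => i; rewrite !mxE; ring.
  apply: (IH _ _ k _ hs' _ Tk _ e') => //.
    by rewrite big_cons htD htD htN; lra.
  by move=> x; rewrite in_cons => /orP[/eqP->|/hr'].
- have [Tk' bc0] := T2 _ _ _ Tk Bb Cc f.
  have e' : \sum_(x <- rem b s) x + (k + (b - c)) = \sum_(x <- rem c r) x.
    by apply: (addrI c); rewrite -e; apply/rowP => i; rewrite !mxE; ring.
  apply: (IH _ _ _ _ hs' hr' Tk' _ e'); first by lra.
  by apply: rn0; rewrite -e' !htD; have := hsum0 _ hs'; rewrite htD in bc0; lra.
Qed.

Definition linear_closed_set (L : V -> Prop) := forall (p : R) u v, L u -> L v -> L (p *: u + v).

(** The trace on [L] of an initial segment of an ordering that refines the root poset. *)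
Definition ideal_of (L Z : V -> Prop) :=
  (forall x, Z x -> pos_root A x /\ L x) /\
  (forall x y, Z x -> pos_root A y -> L y -> nonneg (x - y) -> Z y).

Lemma linear_closed_setB (L : V -> Prop) u v : linear_closed_set L -> L u -> L v -> L (u - v).
Proof. by move=> hL hu hv; rewrite addrC -scaleN1r; apply: hL. Qed.

Lemma closed_add (Z B : V -> Prop) x y : closed_in Z B -> B x -> B y -> Z (x + y) -> B (x + y).
Proof.
move=> [_ h] Bx By; apply: h Bx By _; apply/nspan_pairE; exists 1, 1.
by rewrite !scale1r.
Qed.

(** The positive one of [b - c], [c - b] lies below [b] or [c], hence in [Z]. If it had the wrong
    colour, closure under addition would give [b] or [c] the wrong colour as well. *)
Lemma biclosed_step (L Z B : V -> Prop) b c : linear_closed_set L -> ideal_of L Z ->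
  biclosed_in Z B -> B b -> setminus Z B c -> '[b, c] = 1 ->
  B (b - c) \/ setminus Z B (c - b).
Proof.
move=> hL [ZX hI] [cB cC] Bb Cc f.
have Zb := cB.1 _ Bb; have Zc := Cc.1.
have [Xb Lb] := ZX _ Zb; have [Xc Lc] := ZX _ Zc.
have [rb pb] := (pos_rootE b).1 Xb; have [rc pc] := (pos_rootE c).1 Xc.
case: (root_pos_or (root_sub rb rc f)) => hd.
  have Zd : Z (b - c).
    by apply: (hI b) => //; [apply: linear_closed_setB|rewrite subKr].
  left; have [//|nB] := pselect (B (b - c)); exfalso.
  have := closed_add cC Cc (conj Zd nB); rewrite addrC subrK => /(_ Zb) [] //.
rewrite opprB in hd.
have Zd : Z (c - b).
  by apply: (hI c) => //; [apply: linear_closed_setB|rewrite subKr].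
right; split=> // hB; case: Cc => _; apply.
by have := closed_add cB Bb hB; rewrite addrC subrK => /(_ Zc).
Qed.

Lemma biclosedC (Z B : V -> Prop) : biclosed_in Z B -> biclosed_in Z (setminus Z B).
Proof.
move=> [cB cC]; split; first exact: cC.
rewrite /coclosed_in; have -> : setminus Z (setminus Z B) = B; last exact: cB.
apply/funext => x; apply/propext; split=> [[Zx h]|Bx].
  by have [//|nB] := pselect (B x); case: h.
by split; [exact: cB.1|case].
Qed.

(** The descent runs with [0] as the only isotropic term: a pair with [(b, c) = 2] would coincide.
    Its final sum is isotropic, hence zero, against its positive height. *)
Lemma finite_clean (L Z : V -> Prop) : linear_closed_set L -> ideal_of L Z ->
  (forall x, L x -> rad x -> x = 0) -> clean Z.
Proof.
move=> hL hI hR B BZ bB v vB vC; apply/eqP/negPn/negP => /eqP vn.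
have [ZX _] := hI.
have Bp x : B x -> pos_root A x by move/BZ/ZX => [].
have Cp x : setminus Z B x -> pos_root A x by move=> [/ZX [] ].
have [||s [r [hs hr sn e]]] := int_relation_lists _ _ vB vC vn.
- by move=> x /Bp[/root_integral].
- by move=> x /Cp[/root_integral].
have rn : r <> [::].
  move=> r0; have := ht_sum_gt0 (fun x hx => Bp x (hs x hx)) sn.
  by rewrite e r0 big_nil /ht big1 ?ltxx // => i _; rewrite mxE.
have [||||s' [r' [k' [[hs' hr' Tk' rn' e'] [rv _]]]]] :=
  relation_descent (T := fun k => k = 0) Bp Cp _ _ _ hs hr erefl rn _.
- by move=> k ->; split; [move=> w; rewrite form0l|apply: nonneg0].
- move=> k b c -> Bb Cc f; exfalso.
  have [rb _] := Bp _ Bb; have [rc _] := Cp _ Cc.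
  have : b - c = 0.
    apply: hR; last by apply: form2_rad.
    by apply: linear_closed_setB => //; [case: (ZX _ (BZ _ Bb))|case: (ZX _ Cc.1)].
  by move/eqP; rewrite subr_eq0 => /eqP ebc; case: Cc => _; rewrite -ebc.
- by move=> b c Bb Cc; apply: biclosed_step hL hI bB Bb Cc.
- by rewrite addr0.
have L0 : L 0.
  case: r' rn' hr' {rv e'} => // x r' _ /(_ x (mem_head _ _)) [/ZX [_ Lx] _].
  by rewrite -(subrr x); apply: linear_closed_setB.
have := ht_sum_gt0 (fun x hx => Cp x (hr' x hx)) rn'; rewrite (hR _ _ rv).
  by rewrite /ht big1 ?ltxx // => i _; rewrite mxE.
elim: r' hr' {rn' rv e'} => [|x r' IH] hr'; first by rewrite big_nil.
rewrite big_cons -(scale1r x); apply: hL.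
  by have [/ZX []] := hr' x (mem_head _ _).
by apply: IH => y hy; apply: hr'; rewrite in_cons hy orbT.
Qed.

(** * Affine subsystems of type A2 *)

Section AffineA2.
Variables (al : 'I_3 -> V) (L Z : V -> Prop).
Hypothesis al_pos : forall e, pos_root A (al e).
Hypothesis al_form : forall e f, e != f -> '[al e, al f] = - 1.
Hypothesis L_lin : linear_closed_set L.
Hypothesis L_al : forall e, L (al e).
Hypothesis Z_ideal : ideal_of L Z.
Implicit Types (e f g : 'I_3) (p q o : nat) (t : bool).

Definition a2_delta : V := \sum_e al e.
Local Notation delta := a2_delta.

(* [delta] is isotropic. With [-1] raised to a boolean, the positive roots of the affine
   system with simple roots [al] are [al e + p delta] and [- al e + (p + 1) delta]. *)
Definition a2_root t e p : V := (-1) ^+ t *: al e + (p + t)%:R *: delta.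
Local Notation X := a2_root.

Hypothesis frame : forall x, pos_root A x -> L x -> exists t e p, x = X t e p.

(** In this section [uniq [:: e; f; g]] serves as an enumeration of the three nodes. *)
Lemma ord3_third e f : e != f -> exists g, uniq [:: e; f; g].
Proof.
move=> ef; suff /card_gt0P[g] : (0 < #|~: [set e; f]|)%N.
  rewrite !inE negb_or => /andP[ge gf]; exists g.
  by rewrite /= !inE negb_or ef eq_sym ge eq_sym gf.
by rewrite cardsCs setCK card_ord cards2 ef.
Qed.

Lemma ord3_others e : exists f g, uniq [:: e; f; g].
Proof.
have [f] : exists f, e != f.
  by have [->|h] := eqVneq e ord0; [exists ord_max|exists ord0].
by move=> /ord3_third[g h]; exists f, g.
Qed.

Lemma delta_sum e f g : uniq [:: e; f; g] -> delta = al e + al f + al g.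
Proof.
move=> u; have h : [:: e; f; g] =i predT.
  by apply/subset_cardP; [rewrite (card_uniqP u) card_ord | apply/subsetP].
transitivity (\sum_(x in [:: e; f; g]) al x); first by apply: eq_bigl => x; rewrite h.
by rewrite -big_uniq //= !big_cons big_nil /= addr0 addrA.
Qed.

Lemma uniq3P e f g : uniq [:: e; f; g] -> [/\ e != f, e != g & f != g].
Proof. by rewrite /= !inE negb_or andbT => /andP[/andP[]]. Qed.

Lemma uniq3C e f g : uniq [:: e; f; g] -> uniq [:: f; e; g].
Proof. by move=> /uniq3P[h1 h2 h3]; rewrite /= !inE !negb_or eq_sym h1 h2 h3. Qed.

Lemma uniq3R e f g : uniq [:: e; f; g] -> uniq [:: f; g; e].
Proof.
by move=> /uniq3P[h1 h2 h3]; rewrite /= !inE !negb_or h3 eq_sym h1 eq_sym h2.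
Qed.

Lemma rad_delta : rad delta.
Proof.
have [f [g u]] := ord3_others ord0; have [h1 h2 h3] := uniq3P u.
apply: isotropic_rad; rewrite (delta_sum u) !formlin !(root_norm (al_pos _).1).
rewrite (formC (al f)) (formC (al g) (al ord0)) (formC (al g)) !al_form //; lra.
Qed.

Lemma delta_nonneg : nonneg delta.
Proof.
have [f [g u]] := ord3_others ord0; rewrite (delta_sum u).
have h e : nonneg (al e) by have /pos_rootE[] := al_pos e.
by apply: nonnegD => //; apply: nonnegD.
Qed.

Lemma delta_ht : 0 < ht delta.
Proof.
have [f [g u]] := ord3_others ord0; rewrite (delta_sum u) !htD.
have h1 := pos_root_ht (al_pos ord0); have h2 := pos_root_ht (al_pos f).
by have h3 := pos_root_ht (al_pos g); lra.
Qed.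

Lemma X_form t e p t' f q :
  '[X t e p, X t' f q] = (-1) ^+ (t (+) t') * '[al e, al f].
Proof.
rewrite /a2_root !formlin !rad_delta (rad_r rad_delta) signr_addb; ring.
Qed.

(** Two roots at 120 degrees add up to the direction between them, as [al e + al f = delta - al g].
    The summand [t] in the level accounts for the extra [delta] carried by each negative
    direction. *)
Lemma X_add t e f g p q : uniq [:: e; f; g] ->
  X t e p + X t f q = X (~~ t) g (p + q + t).
Proof.
move=> u; rewrite /a2_root; have := delta_sum u; move: delta => d dE.
have -> : al g = d - al e - al f by rewrite dE; apply/rowP => i; rewrite !mxE; ring.
case: t; apply/rowP => i; rewrite !mxE /= ?addn0 !natrD ?expr0 ?expr1; ring.
Qed.

Lemma X_opp t e p q : X t e p + X (~~ t) e q = (p + q).+1%:R *: delta.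
Proof.
case: t; rewrite /a2_root -[(p + q).+1]addn1; apply/rowP => i; rewrite !mxE /= ?addn0 !natrD ?expr0 ?expr1; ring.
Qed.

Lemma X_shift t e p q : X t e (p + q) = X t e p + q%:R *: delta.
Proof. rewrite /a2_root; apply/rowP => i; rewrite !mxE !natrD; ring. Qed.

Lemma X_split t e f g p q : uniq [:: e; f; g] -> (q + ~~ t)%N = p ->
  X t e p = X (~~ t) g 0 + X (~~ t) f q.
Proof.
by move=> u <-; rewrite (X_add _ _ _ (uniq3R (uniq3R (uniq3C u)))) negbK add0n.
Qed.

Lemma X_base e : X false e 0 = al e.
Proof. by rewrite /a2_root expr0 scale1r addn0 scale0r addr0. Qed.

(** All these vectors arise from the [al] by adding pairs with form -1; two negative directions of
    levels [p] and 0 produce a positive direction of level [p + 1]. *)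
Lemma X_posL p t e : pos_root A (X t e p) /\ L (X t e p).
Proof.
have add (t0 : bool) e0 f0 g0 p0 q0 : uniq [:: e0; f0; g0] ->
    pos_root A (X t0 e0 p0) /\ L (X t0 e0 p0) -> pos_root A (X t0 f0 q0) /\ L (X t0 f0 q0) ->
    pos_root A (X (~~ t0) g0 (p0 + q0 + t0)) /\ L (X (~~ t0) g0 (p0 + q0 + t0)).
  move=> u [/pos_rootE[r1 n1] l1] [/pos_rootE[r2 n2] l2]; rewrite -(X_add _ _ _ u).
  split; last by rewrite -(scale1r (X t0 e0 p0)); apply: L_lin.
  apply/pos_rootE; split; last exact: nonnegD.
  apply: root_add => //; rewrite X_form addbb mul1r al_form //.
  by have [] := uniq3P u.
have [f [g u]] := ord3_others e; have u' := uniq3R u; have u'' := uniq3C (uniq3R u').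
have base e0 : pos_root A (X false e0 0) /\ L (X false e0 0) by rewrite X_base.
have baseT e0 : pos_root A (X true e0 0) /\ L (X true e0 0).
  have [f0 [g0 u0]] := ord3_others e0.
  by have := add false _ _ _ 0%N 0%N (uniq3R u0) (base _) (base _).
elim: p t e f g u u' u'' => [|p IH] t e f g u u' u''; first by case: t.
have IH' t0 e0 : pos_root A (X t0 e0 p) /\ L (X t0 e0 p).
  have [f0 [g0 u0]] := ord3_others e0.
  exact: IH u0 (uniq3R u0) (uniq3C (uniq3R (uniq3R u0))).
have up e0 : pos_root A (X false e0 p.+1) /\ L (X false e0 p.+1).
  have [f0 [g0 u0]] := ord3_others e0.
  have := add true _ _ _ p 0%N (uniq3R u0) (IH' _ _) (baseT _).
  by rewrite addn0 addn1.
case: t; last exact: up.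
by have := add false _ _ _ p.+1 0%N u' (up _) (base _); rewrite !addn0.
Qed.

Lemma Z_le x y : Z x -> pos_root A y /\ L y -> nonneg (x - y) -> Z y.
Proof. by move=> Zx [Xy Ly]; apply: Z_ideal.2 Zx Xy Ly. Qed.

Lemma X_nonneg t e p : nonneg (X t e p).
Proof. by have [/pos_rootE[]] := X_posL p t e. Qed.

Lemma Z_split t e p x : Z x -> nonneg (x - X t e p) -> Z (X t e p).
Proof. by move=> Zx; apply: Z_le Zx (X_posL _ _ _). Qed.

Lemma Z_addr z t e p t' f q : Z z -> z = X t e p + X t' f q -> Z (X t' f q).
Proof.
by move=> Zz zE; apply: Z_split Zz _; rewrite zE addrK; apply: X_nonneg.
Qed.

Lemma Z_down t e p q : (q <= p)%N -> Z (X t e p) -> Z (X t e q).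
Proof.
move=> qp h; apply: Z_split h _; rewrite -(subnKC qp) X_shift addrAC subrr add0r.
by apply: nonnegZ; [apply: ler0n|apply: delta_nonneg].
Qed.

(** [X t' f 0] and its opposite of level 0 sum to [delta], so a root of positive level exceeds every
    root of level 0 by a sum of two positive roots. *)
Lemma Z_base t e p t' f : (0 < p)%N -> Z (X t e p) -> Z (X t' f 0).
Proof.
move=> p0 h; apply: Z_split h _.
have -> : X t e p - X t' f 0 = X t e p.-1 + X (~~ t') f 0.
  apply: (addIr (X t' f 0)); rewrite subrK -addrA [X (~~ t') f 0 + _]addrC X_opp addn0.
  by rewrite -X_shift addn1 prednK.
by apply: nonnegD; apply: X_nonneg.
Qed.

(** * Colours along a direction *)

Lemma X_between t e p q o : (p <= q)%N -> (q <= o)%N ->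
  nspan (pair_set (X t e p) (X t e o)) (X t e q).
Proof.
move=> pq qo; apply/nspan_pairE.
have [po|po] := eqVneq p o.
  exists 1, 0; have -> : q = p by lia.
  by rewrite scale1r scale0r addr0 ler01 lexx.
have -> : X t e q = X t e p + (q - p)%:R *: delta by rewrite -X_shift subnKC.
have -> : X t e o = X t e p + (o - p)%:R *: delta by rewrite -X_shift subnKC //; lia.
have : (q - p)%:R <= (o - p)%:R :> R by rewrite ler_nat; lia.
have : 0 < (o - p)%:R :> R by rewrite ltr0n; lia.
have : 0 <= (q - p)%:R :> R by apply: ler0n.
move: ((q - p)%:R) ((o - p)%:R) => r d r0 d0 rd; move: delta (X t e p) => v x.
exists ((d - r) / d), (r / d); rewrite !divr_ge0 ?subr_ge0 ?(ltW d0) //; split=> //.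
by apply/rowP => i; rewrite !mxE; field; rewrite gt_eqF.
Qed.

(** Opposite directions sum to a positive multiple of [delta], which pushes [X t e p] up to any
    higher level. *)
Lemma X_beyond t e p q o : (p <= q)%N ->
  nspan (pair_set (X t e p) (X (~~ t) e o)) (X t e q).
Proof.
move=> pq; apply/nspan_pairE; have := X_opp t e p o.
set d : R := (p + o).+1%:R => hd; have d0 : 0 < d by rewrite ltr0n.
pose r : R := (q - p)%:R / d; have r0 : 0 <= r by rewrite divr_ge0 ?ler0n // ltW.
exists (1 + r), r; split=> //; first by rewrite addr_ge0.
rewrite scalerDl scale1r -addrA -scalerDr hd scalerA /r divfK ?gt_eqF //.
by rewrite -X_shift subnKC.
Qed.

(** Biclosedness in a form symmetric in the two colours, so that every lemma applies with [P] and
    [Q] exchanged. *)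
Definition colored (P Q : V -> Prop) :=
  [/\ closed_in Z P, closed_in Z Q, forall x, Z x -> P x \/ Q x & forall x, P x -> Q x -> False].

Lemma coloredC P Q : colored P Q -> colored Q P.
Proof.
by case=> h1 h2 h3 h4; split=> // [x /h3 []|x h5 h6]; [right|left|apply: h4 h6 h5].
Qed.

(** By convexity a direction changes colour at most once; [P] is the low colour, [Q] the high
    one. *)
Definition flips (P Q : V -> Prop) t e :=
  exists p q, [/\ P (X t e p), Q (X t e q) & (p < q)%N].

Section Colors.
Variables (P Q : V -> Prop).
Hypothesis PQ : colored P Q.

Let PZ x : P x -> Z x. Proof. by case: PQ => -[h _] _ _ _; apply: h. Qed.
Let QZ x : Q x -> Z x. Proof. by case: PQ => _ [h _] _ _; apply: h. Qed.
Let PQ_or x : Z x -> P x \/ Q x. Proof. by case: PQ => _ _ h _; apply: h. Qed.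
Let PQF x : P x -> Q x -> False. Proof. by case: PQ => _ _ _; apply. Qed.
Let P_span x y z : P x -> P y -> nspan (pair_set x y) z -> Z z -> P z.
Proof. by case: PQ => -[_ h] _ _ _; apply: h. Qed.
Let Q_span x y z : Q x -> Q y -> nspan (pair_set x y) z -> Z z -> Q z.
Proof. by case: PQ => _ [_ h] _ _; apply: h. Qed.

Lemma flips_Z t e t' f : flips P Q t e -> Z (X t' f 0).
Proof. by case=> p [q [_ h pq]]; apply: Z_base (QZ h); lia. Qed.

Lemma flips_low t e : flips P Q t e -> P (X t e 0).
Proof.
move=> hf; have [//|h] := PQ_or (flips_Z t e hf).
have [p [q [hp hq pq]]] := hf; case: (PQF hp).
by apply: Q_span h hq (X_between _ _ _ _) (PZ hp) => //; lia.
Qed.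

(** A [P] root of the opposite direction, together with a low [P] root, would span the [Q] root
    above it. *)
Lemma flips_opp t e q : flips P Q t e -> Z (X (~~ t) e q) -> Q (X (~~ t) e q).
Proof.
move=> [p [o [hp ho po]]] hz; have [h|//] := PQ_or hz.
case: (PQF _ ho); apply: P_span hp h (X_beyond _ _ _ _) (QZ ho); lia.
Qed.
End Colors.

(* The roots of directions [e] and [f] at 120 degrees that have switched colour
   both split off the lowest root of the direction between them. *)
Lemma flips_obtuse P Q t e f : colored P Q -> e != f ->
  flips P Q t e -> flips Q P t f -> False.
Proof.
move=> PQ ef h1 h2; have QP := coloredC PQ.
have [cP cQ or PQF] := PQ.
have [g u] := ord3_third ef; have [p [q [_ hq pq]]] := h1; have [p' [q' [_ hq' pq']]] := h2.
have Zg : Z (X (~~ t) g 0) := flips_Z PQ _ _ h1.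
have eq : X t e q = X (~~ t) g 0 + X (~~ t) f (q - ~~ t) by apply: (X_split u); case: t {h1 h2 hq hq' Zg}; lia.
have eq' : X t f q' = X (~~ t) g 0 + X (~~ t) e (q' - ~~ t).
  by apply: (X_split (uniq3C u)); case: t {h1 h2 hq hq' Zg eq}; lia.
have Zq : Z (X t e q) by apply: cQ.1. have Zq' : Z (X t f q') by apply: cP.1.
have [hg|hg] := or _ Zg.
  have hf : P (X (~~ t) f (q - ~~ t)).
    by apply: (flips_opp QP h2); apply: Z_addr Zq eq.
  by apply: (PQF _ _ hq); move: Zq; rewrite eq; apply: closed_add cP hg hf.
have he : Q (X (~~ t) e (q' - ~~ t)).
  by apply: (flips_opp PQ h1); apply: Z_addr Zq' eq'.
by apply: (PQF _ hq'); move: Zq'; rewrite eq'; apply: closed_add cQ hg he.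
Qed.

(** Directions at 60 degrees: the high roots [X false e k] and [X true f m] differ by a root of the
    third direction, whose colour is forced, while level 0 of that direction has the other colour.
    So the third direction changes colour too, and is obtuse to one of the given two with the
    opposite sense. *)
Lemma flips_acute P Q e f : colored P Q -> e != f ->
  flips P Q false e -> flips Q P true f -> False.
Proof.
move=> PQ ef h1 h2; have QP := coloredC PQ.
have [cP cQ or PQF] := PQ.
have [g u] := ord3_third ef; have [p [k [_ hk pk]]] := h1; have [p' [m [_ hm pm]]] := h2.
have [ef' eg fg] := uniq3P u.
have Zk : Z (X false e k) by apply: cQ.1. have Zm : Z (X true f m) by apply: cP.1.
have Z0 t e0 : Z (X t e0 0) := flips_Z PQ _ _ h1.
have [mk|km] := ltnP m k.
  have E : X false e k = X true f m + X true g (k - m).-1.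
    by rewrite (X_add _ _ _ (uniq3R u)) /=; congr X; lia.
  have Zy : Z (X true g (k - m).-1) by apply: Z_addr Zk E.
  have Qy : Q (X true g (k - m).-1).
    have [Py|//] := or _ Zy; case: (PQF _ _ hk).
    by move: Zk; rewrite E; apply: closed_add cP hm Py.
  have Pg : P (X true g 0).
    have E0 : X true g 0 = X false e 0 + X false f 0 by rewrite (X_add _ _ _ u).
    rewrite E0; apply: closed_add cP (flips_low PQ h1) _ _; last by rewrite -E0.
    exact: (flips_opp QP h2).
  apply: (flips_obtuse PQ (t := true) (e := g) (f := f)) h2; first by rewrite eq_sym.
  exists 0%N, (k - m).-1; split=> //.
  by rewrite lt0n; apply/eqP => k0; move: Qy; rewrite k0; apply: PQF.
have E : X true f m = X false e k + X false g (m - k).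
  by rewrite (X_add _ _ _ (uniq3R (uniq3C u))) /=; congr X; lia.
have Zy : Z (X false g (m - k)) by apply: Z_addr Zm E.
have Py : P (X false g (m - k)).
  have [//|Qy] := or _ Zy; case: (PQF _ hm).
  by move: Zm; rewrite E; apply: closed_add cQ hk Qy.
have Qg : Q (X false g 0).
  have [Pg|//] := or _ (Z0 false g).
  have E0 : X true f 0 = X false e 0 + X false g 0.
    by rewrite (X_add _ _ _ (uniq3R (uniq3C u))).
  case: (PQF _ _ (flips_low QP h2)); rewrite E0.
  by apply: closed_add cP (flips_low PQ h1) Pg _; rewrite -E0.
apply: (flips_obtuse PQ (t := false) (e := e) (f := g)) h1 _ => //.
exists 0%N, (m - k)%N; split=> //.
by rewrite lt0n; apply/eqP => k0; move: Py => /PQF; apply; rewrite k0.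
Qed.

(** Angles of 120 and 60 degrees are treated above. For equal directions level 0 would have both
    colours; for opposite ones [flips_opp] leaves the second direction only [Q] roots. *)
Lemma flips_same_side P Q t e t' f : colored P Q -> flips P Q t e -> flips Q P t' f -> False.
Proof.
move=> PQ h1 h2; have QP := coloredC PQ; have [cP cQ or PQF] := PQ.
have [ef|ef] := eqVneq e f; last first.
  case: t t' h1 h2 => -[] h1 h2.
  - exact: flips_obtuse PQ ef h1 h2.
  - by apply: flips_acute QP _ h2 h1; rewrite eq_sym.
  - exact: flips_acute PQ ef h1 h2.
  - exact: flips_obtuse PQ ef h1 h2.
subst f; have [tt|tt] := eqVneq t t'.
  by subst t'; apply: PQF _ (flips_low PQ h1) (flips_low QP h2).
have {}tt : t' = ~~ t by case: t t' tt {h1 h2} => -[].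
have [p [q [_ hq _]]] := h2; rewrite tt in hq.
exact: PQF _ hq (flips_opp PQ h1 (cP.1 _ hq)).
Qed.

(** The cone of the low colour avoids [delta] in this sense. Otherwise, adding the two opposite
    roots in turn to [X t e p] raises its level by one within [P], and the direction never changes
    colour. *)
Lemma no_opposite_pair P Q t e t' f : colored P Q -> flips P Q t e ->
  P (X t' f 0) -> P (X (~~ t') f 0) -> False.
Proof.
move=> PQ hf.
suff main : P (X t f 0) -> P (X (~~ t) f 0) -> False.
  by case: t t' {hf} main => -[] //= main h1 h2; apply: main.
move=> h1 h2; have [cP cQ or PQF] := PQ.
have [ef|ef] := eqVneq e f.
  by subst f; apply: PQF _ h2 (flips_opp PQ hf (cP.1 _ h2)).
have [g u] := ord3_third ef.
have all_P p : Z (X t e p) -> P (X t e p).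
  elim: p => [_|p IH Zp]; first exact (flips_low PQ hf).
  have E : X t e p.+1 = X (~~ t) f 0 + X (~~ t) g (p + t).
    by by apply: (X_split (uniq3R (uniq3C u))); case: (t) => /=; lia.
  have E' : X (~~ t) g (p + t) = X t e p + X t f 0 by rewrite (X_add _ _ _ u) addn0.
  have Zg : Z (X (~~ t) g (p + t)) by apply: Z_addr Zp E.
  have Pg : P (X (~~ t) g (p + t)).
    rewrite E'; apply: closed_add cP (IH _) h1 _; last by rewrite -E'.
    exact: Z_down (leqnSn p) Zp.
  by rewrite E; apply: closed_add cP h2 Pg _; rewrite -E.
by have [p [q [_ hq _]]] := hf; apply: (PQF _ _ hq); apply: all_P; apply: cQ.1 hq.
Qed.

Lemma sum_form_neg (s : seq V) w x : rad (\sum_(y <- s) y) -> x \in s -> 0 < '[x, w] ->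
  exists2 y, y \in s & '[y, w] < 0.
Proof.
move=> rs xs hx; have [//|h] := pselect (exists2 y, y \in s & '[y, w] < 0).
have h' y : y \in s -> - '[y, w] <= 0.
  by move=> ys; rewrite oppr_le0 leNgt; apply/negP => hy; apply: h; exists y.
have := sum_le0_seq (F := fun y => - '[y, w]) h'.
rewrite sumrN -form_suml rs oppr0 => /(_ erefl x xs); lra.
Qed.

Lemma al_norm e : '[al e, al e] = 2.
Proof. exact: root_norm (al_pos e).1. Qed.

(* A combination of roots of one colour that vanishes modulo [delta] contains
   either two opposite directions or three directions at 120 degrees. *)
Lemma flips_isotropic_sum P Q t e (s : seq V) : colored P Q -> flips P Q t e ->
  (forall x, x \in s -> P x) -> s <> [::] -> rad (\sum_(x <- s) x) -> False.
Proof.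
move=> PQ hf hs sn rs; have [cP cQ or PQF] := PQ.
have noQP t1 e1 : ~ flips Q P t1 e1 by apply: flips_same_side PQ hf.
have Xs x : x \in s -> exists t1 e1 p, x = X t1 e1 p.
  by move=> /hs /(cP.1) /(Z_ideal.1)[]; apply: frame.
have low t1 e1 p : P (X t1 e1 p) -> P (X t1 e1 0).
  move=> hp; have [//|hq] := or _ (flips_Z PQ t1 e1 hf).
  case: (noQP t1 e1); exists 0%N, p; split=> //.
  by rewrite lt0n; apply/eqP => p0; apply: (PQF _ _ hq); rewrite -{1}p0.
have [x xs] : exists x, x \in s by case: s sn {hs rs Xs} => // y s _; exists y; rewrite mem_head.
have [t1 [f [p xE]]] := Xs _ xs.
have opp : forall q, X (~~ t1) f q \in s -> False.
  move=> q /hs /low h2; have := hs _ xs; rewrite xE => /low h1.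
  exact: no_opposite_pair PQ hf h1 h2.
(* [w] pairs to 3 with [x]. Only directions opposite to [x], or [(t1, g)], pair negatively with it,
   and one of them must occur since the sum is radical. *)
have same g : f != g -> P (X t1 g 0).
  move=> fg; pose w := (-1) ^+ t1 *: (al f - al g).
  have form_w t2 m q : '[X t2 m q, w] = (-1) ^+ (t1 (+) t2) * ('[al m, al f] - '[al m, al g]).
    rewrite /w /a2_root !formlin !rad_delta signr_addb; ring.
  have [|y ys] := sum_form_neg (w := w) rs xs.
    by rewrite xE form_w addbb mul1r al_norm al_form //; lra.
  have [t2 [m [q yE]]] := Xs _ ys; rewrite yE in ys *; rewrite form_w.
  have [mf|mf] := eqVneq m f.
    subst m; rewrite al_norm al_form //; case: (t1 =P t2) => [<-|/eqP tt].
      by rewrite addbb mul1r => h; exfalso; apply: (@one_le0F R); lra.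
    have t2E : t2 = ~~ t1 by case: t1 t2 tt {xE opp form_w w ys yE} => -[].
    by subst t2; case: (opp q).
  have [mg|mg] := eqVneq m g; last first.
    by rewrite !al_form // subrr mulr0 ltxx.
  subst m; rewrite al_norm al_form //; case: (t1 =P t2) => [t12|/eqP tt].
    by subst t2 => _; apply: low (hs _ ys).
  have -> : t1 (+) t2 = true by case: t1 t2 tt {xE opp form_w w ys yE} => -[].
  by rewrite expr1 => h; exfalso; apply: (@one_le0F R); lra.
have all_low g : P (X t1 g 0).
  have [<-|] := eqVneq f g; last exact: same.
  by apply: low (p) _; rewrite -xE; apply: hs.
have [g [m u]] := ord3_others e.
have Z0 t2 e2 : Z (X t2 e2 0) := flips_Z PQ t2 e2 hf.
have no_opp e2 : ~ P (X (~~ t1) e2 0).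
  by move=> h2; apply: no_opposite_pair PQ hf (all_low e2) h2.
have Qlow e2 : Q (X (~~ t1) e2 0) by have [/no_opp|] := or _ (Z0 (~~ t1) e2).
case: t1 {xE opp same} all_low no_opp Qlow => all_low no_opp Qlow.
  have E : X true e 0 = X false g 0 + X false m 0 by rewrite (X_add _ _ _ (uniq3R u)).
  apply: (PQF _ (all_low e)); rewrite E.
  by apply: closed_add cQ (Qlow _) (Qlow _) _; rewrite -E.
have E : X true e 0 = X false g 0 + X false m 0 by rewrite (X_add _ _ _ (uniq3R u)).
apply: (no_opp e); rewrite /= E.
by apply: closed_add cP (all_low _) (all_low _) _; rewrite -E.
Qed.

Lemma colored_no_relation (P Q : V -> Prop) (s r : seq V) :
  colored P Q -> (forall t e, ~ flips P Q t e) ->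
  (forall b c, P b -> Q c -> '[b, c] = 1 -> P (b - c) \/ Q (c - b)) ->
  (forall x, x \in s -> P x) -> (forall x, x \in r -> Q x) -> r <> [::] ->
  \sum_(x <- s) x = \sum_(x <- r) x -> False.
Proof.
move=> PQ nf step hs hr rn e0; have QP := coloredC PQ; have [cP cQ or PQF] := PQ.
have ZX x : Z x -> exists t e p, x = X t e p by move=> /(Z_ideal.1)[]; apply: frame.
have Pp x : P x -> pos_root A x by move=> /(cP.1) /(Z_ideal.1)[].
have Qp x : Q x -> pos_root A x by move=> /(cQ.1) /(Z_ideal.1)[].
(* A nonzero isotropic term records its origin: as no direction passes from [P] to [Q], a pair with
   [(b, c) = 2] has [c] below [b] and exhibits a change from [Q] to [P]. *)
pose T k := k = 0 \/ (exists t e, flips Q P t e) /\ exists2 c : R, 0 <= c & k = c *: delta.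
have [||||s' [r' [k [[hs' hr' Tk rn' e'] [rv orth]]]]] :=
  relation_descent (T := T) Pp Qp _ _ step hs hr _ rn (_ : _ + 0 = _).
- move=> k [->|[_ [c c0 ->]]]; first by split; [move=> w; rewrite form0l|apply: nonneg0].
  by split; [apply: radZ; apply: rad_delta|apply: nonnegZ => //; apply: delta_nonneg].
- move=> k b c Tk Pb Qc f.
  have [t [e [p bE]]] := ZX _ (cP.1 _ Pb); have [t' [e' [q cE]]] := ZX _ (cQ.1 _ Qc).
  rewrite bE cE X_form in f.
  have ee : e = e'.
    apply/eqP; apply: contraPT f => ee; rewrite al_form //.
    by case: (t (+) t'); rewrite ?expr0 ?expr1 => f; apply: (@one_le0F R); lra.
  subst e'; rewrite al_norm in f.
  have tt : t = t'.
    case: (t =P t') => // /eqP tt; exfalso; move: f.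
    have -> : t (+) t' = true by case: t t' tt {bE cE} => -[].
    by rewrite expr1 => f; apply: (@one_le0F R); lra.
  subst t'; have qp : (q < p)%N.
    rewrite ltnNge; apply/negP; rewrite leq_eqVlt => /orP[/eqP pq|pq].
      by apply: (PQF b) => //; rewrite bE pq -cE.
    by apply: (nf t e); exists p, q; rewrite -bE -cE.
  have bcE : b - c = (p - q)%:R *: delta.
    by rewrite bE cE -(subnKC (ltnW qp)) X_shift addrAC subrr add0r addKn.
  have pq0 : 0 < (p - q)%:R :> R by rewrite ltr0n subn_gt0.
  split; last by rewrite bcE htZ mulr_gt0 ?delta_ht.
  right; split; first by exists t, e, q, p; rewrite -bE -cE.
  rewrite bcE; case: Tk => [->|[_ [d d0 ->]]].
    by exists (p - q)%:R; rewrite ?add0r // ltW.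
  by exists (d + (p - q)%:R); rewrite ?scalerDl // addr_ge0 // ltW.
- by left.
- by rewrite addr0.
(* All pairings of these roots are ±1 or ±2, so mixed pairs cannot be orthogonal and one list must
   be empty. *)
have s'0 : s' = [::].
  case: s' hs' orth {e'} => // b s' hs' orth; exfalso.
  case: r' hr' rn' orth {rv} => // c r' hr' _ /(_ b c (mem_head _ _) (mem_head _ _)).
  have [t [e [p ->]]] := ZX _ (cP.1 _ (hs' _ (mem_head _ _))).
  have [t' [e' [q ->]]] := ZX _ (cQ.1 _ (hr' _ (mem_head _ _))).
  rewrite X_form => /eqP; rewrite mulf_eq0 signr_eq0 /=.
  have [<-|ee] := eqVneq e e'; first by rewrite al_norm => /eqP h; apply: (@one_le0F R); lra.
  by rewrite al_form // => /eqP h; apply: (@one_le0F R); lra.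
case: Tk => [k0|[[t [e hf]] _]]; last exact: flips_isotropic_sum QP hf hr' rn' rv.
have := ht_sum_gt0 (fun x hx => Qp x (hr' x hx)) rn'.
by rewrite -e' s'0 k0 big_nil addr0 /ht big1 ?ltxx // => i _; rewrite mxE.
Qed.

Lemma affine_A2_clean : clean Z.
Proof.
move=> B BZ bB v vB vC; apply/eqP/negPn/negP => /eqP vn.
have bC := biclosedC bB; set C := setminus Z B in vC bC.
have BC : colored B C.
  split; [exact: bB.1|exact: bB.2| |by move=> x Bx []].
  by move=> x Zx; have [Bx|nB] := pselect (B x); [left|right].
have CB := coloredC BC.
have Bp x : B x -> pos_root A x by move=> /BZ /(Z_ideal.1)[].
have Cp x : C x -> pos_root A x by move=> [/(Z_ideal.1)[]].
have [||s [r [hs hr sn e0]]] := int_relation_lists _ _ vB vC vn.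
- by move=> x /Bp[/root_integral].
- by move=> x /Cp[/root_integral].
have rn : r <> [::].
  move=> r0; have := ht_sum_gt0 (fun x hx => Bp x (hs x hx)) sn.
  by rewrite e0 r0 big_nil /ht big1 ?ltxx // => i _; rewrite mxE.
have stepB b c : B b -> C c -> '[b, c] = 1 -> B (b - c) \/ C (c - b).
  exact: biclosed_step L_lin Z_ideal bB.
have stepC c b : C c -> B b -> '[c, b] = 1 -> C (c - b) \/ B (b - c).
  by move=> Cc Bb; rewrite formC => /(stepB _ _ Bb Cc)[]; [right|left].
(* Colour changes in both senses are excluded, so one of the two orders of the colours has none. *)
have [[t [e hf]]|nf] := pselect (exists t e, flips B C t e).
  apply: (colored_no_relation CB _ stepC hr hs sn); last by rewrite e0.
  by move=> t' e'; apply: flips_same_side BC hf.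
apply: (colored_no_relation BC _ stepB hs hr rn e0) => t e hf.
by apply: nf; exists t, e.
Qed.

End AffineA2.

(** * Existence of a base in the affine case *)

(** The reflection in [u] followed by that in [u + k] is the translation sending [z] to
    [z + (z, u) k]. *)
Lemma root_translate z u k (m : nat) : is_root A z -> is_root A u -> is_root A (u + k) -> rad k ->
  is_root A (z + (m%:R * '[z, u]) *: k).
Proof.
move=> rz ru ruk rk; elim: m => [|m IH]; first by rewrite mul0r scale0r addr0.
have := root_reflect ruk (root_reflect ru IH); congr is_root.
rewrite !formlin !(rad_r rk) !rk (root_norm ru) -natr1; apply/rowP => i; rewrite !mxE; ring.
Qed.

(** A long enough translation makes one coordinate positive, and then sign coherence makes the root
    positive. Trading [(u, k)] for [(u + k, - k)] adjusts the direction. *)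
Lemma translate_pos z u k : is_root A z -> is_root A u -> is_root A (u + k) -> rad k ->
  k <> 0 -> '[z, u] != 0 -> exists c : R, pos_root A (z + c *: k).
Proof.
move=> rz ru ruk rk nk zu.
have [i ki] : exists i, k 0 i != 0.
  apply/existsP; apply: contraT; rewrite negb_exists => /forallP h; case: nk.
  by apply/rowP => i; have := h i; rewrite negbK [RHS]mxE => /eqP.
have main u' k' : is_root A u' -> is_root A (u' + k') -> rad k' -> 0 < '[z, u'] * k' 0 i ->
    exists c : R, pos_root A (z + c *: k').
  move=> ru' ruk' rk' d0; set d := _ * _ in d0.
  pose m := Num.bound (`|z 0 i| / d).
  have mP : `|z 0 i| < m%:R * d.
    by rewrite -ltr_pdivrMr //; apply: archi_boundP; rewrite divr_ge0 // ltW.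
  have rm := root_translate m rz ru' ruk' rk'.
  exists (m%:R * '[z, u']); case: (root_pos_or rm) => // /pos_rootE[_ /(_ i)].
  have -> : (- (z + (m%:R * '[z, u']) *: k')) 0 i = - (z 0 i + m%:R * d).
    by rewrite /d !mxE; ring.
  by have := ler_norm (- z 0 i); rewrite normrN => h1 h2; exfalso; apply: (@one_le0F R); lra.
have : '[z, u] * k 0 i != 0 by rewrite mulf_neq0.
rewrite neq_lt => /orP[h|h]; last exact: main ruk rk h.
have [|||c hc] := main (u + k) (- k) ruk.
- by rewrite addrK.
- exact: radN.
- by rewrite formDr (rad_r rk) addr0 mxE mulrN oppr_gt0.
by exists (- c); rewrite scaleNr -scalerN.
Qed.

Lemma pos_root_ht_nat x : pos_root A x -> exists m : nat, ht x = m%:R.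
Proof.
move=> /pos_rootE[/root_integral[z ->] px].
exists (\sum_i absz (z 0 i)); rewrite natr_sum; apply: eq_bigr => i _.
have := px i; rewrite !mxE ler0z => zi.
by rewrite natr_absz ger0_norm.
Qed.

Section Frame.
Variables (a b k : V).
Hypothesis (ra : is_root A a) (rb : is_root A b) (ab : '[a, b] = - 1).
Hypothesis (rk : rad k) (nk : k <> 0).
Implicit Types (e f g : 'I_3) (al : 'I_3 -> V).

Definition a2_dir e : V := nth 0 [:: a; b; - (a + b)] e.

(** Candidates for the base: the common sign [t] makes the roots pairwise obtuse and their sum a
    multiple of [k]. *)
Definition a2_triple al := (forall e, pos_root A (al e)) /\
  exists (t : bool) (c : 'I_3 -> R), forall e, al e = (-1) ^+ t *: a2_dir e + c e *: k.

Definition a2_plane x := exists p q c : R, x = p *: a + q *: b + c *: k.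

Lemma ord3P e : [\/ e = ord0, e = lift ord0 ord0 | e = ord_max].
Proof.
by case: e => -[|[|[|//]]] h; [constructor 1|constructor 2|constructor 3]; apply: val_inj.
Qed.

Lemma a2_dir_norm e : '[a2_dir e, a2_dir e] = 2.
Proof.
by case: (ord3P e) => ->; rewrite /a2_dir /= ?formlin !root_norm // (formC b a) ab; lra.
Qed.

Lemma a2_dir_form e f : e != f -> '[a2_dir e, a2_dir f] = - 1.
Proof.
case: (ord3P e) => ->; case: (ord3P f) => -> //= _; rewrite /a2_dir /= ?formlin ?root_norm //;
  rewrite ?(formC b a) ?ab //; lra.
Qed.

Lemma a2_dir_sum : \sum_e a2_dir e = 0.
Proof.
rewrite !big_ord_recl big_ord0 /a2_dir /=; apply/rowP => i; rewrite !mxE; ring.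
Qed.

Lemma a2_dir_root e : is_root A (a2_dir e).
Proof.
by case: (ord3P e) => ->; rewrite /a2_dir //=; apply: rootN; apply: root_add.
Qed.

Lemma hexagon_dir (p q : R) h : rad h -> is_root A (p *: a + q *: b + h) ->
  exists (t : bool) e, p *: a + q *: b = (-1) ^+ t *: a2_dir e.
Proof.
move=> rh /(hexagon ra rb ab rh)[] [] [-> ->].
- by exists false, ord0; rewrite /a2_dir /=; apply/rowP => i; rewrite !mxE; ring.
- by exists false, (lift ord0 ord0); rewrite /a2_dir /=; apply/rowP => i; rewrite !mxE; ring.
- by exists false, ord_max; rewrite /a2_dir /=; apply/rowP => i; rewrite !mxE; ring.
- by exists true, ord0; rewrite /a2_dir /=; apply/rowP => i; rewrite !mxE; ring.
- by exists true, (lift ord0 ord0); rewrite /a2_dir /=; apply/rowP => i; rewrite !mxE; ring.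
- by exists true, ord_max; rewrite /a2_dir /=; apply/rowP => i; rewrite !mxE; ring.
Qed.

Lemma a2_plane_dir x : is_root A x -> a2_plane x ->
  exists (t : bool) e (c : R), x = (-1) ^+ t *: a2_dir e + c *: k.
Proof.
move=> rx [p [q [c xE]]]; rewrite xE in rx *.
by have [t [e ->]] := hexagon_dir (radZ c rk) rx; exists t, e, c.
Qed.

Lemma a2_dir_plane (t : bool) e (c : R) : a2_plane ((-1) ^+ t *: a2_dir e + c *: k).
Proof.
case: (ord3P e) => ->; rewrite /a2_dir /=.
- by exists ((-1) ^+ t), 0, c; apply/rowP => i; rewrite !mxE; ring.
- by exists 0, ((-1) ^+ t), c; apply/rowP => i; rewrite !mxE; ring.
- by exists (- (-1) ^+ t), (- (-1) ^+ t), c; apply/rowP => i; rewrite !mxE; ring.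
Qed.

Lemma a2_triple_exists u : is_root A u -> is_root A (u + k) ->
  (forall e, '[a2_dir e, u] != 0) -> exists al, a2_triple al.
Proof.
move=> ru ruk hu.
have /fin_all_exists[c hc] e : exists c : R, pos_root A (a2_dir e + c *: k).
  exact: translate_pos (a2_dir_root e) ru ruk rk nk (hu e).
exists (fun e => a2_dir e + c e *: k); split=> //; exists false, c => e.
by rewrite expr0 scale1r.
Qed.

(* A triple of minimal height is the base of the affine subsystem. *)
Lemma a2_triple_min al0 : a2_triple al0 -> exists2 al, a2_triple al &
  forall al', a2_triple al' -> ht (\sum_e al e) <= ht (\sum_e al' e).
Proof.
move=> h0; pose P m := exists2 al, a2_triple al & ht (\sum_e al e) = m%:R.
have natP al : a2_triple al -> exists m, ht (\sum_e al e) = m%:R.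
  move=> [hp _]; rewrite !big_ord_recl big_ord0 !htD.
  have [m1 ->] := pos_root_ht_nat (hp ord0).
  have [m2 ->] := pos_root_ht_nat (hp (lift ord0 ord0)).
  have [m3 ->] := pos_root_ht_nat (hp (lift ord0 (lift ord0 ord0))).
  exists (m1 + (m2 + m3))%N; rewrite !natrD; congr (_ + (_ + _)).
  by rewrite /ht big1 ?addr0 // => i _; rewrite mxE.
have exP : exists m, `[< P m >].
  by have [m hm] := natP _ h0; exists m; apply/asboolP; exists al0.
case: (ex_minnP exP) => m /asboolP[al tal alE] hmin.
exists al => // al' tal'; have [m' em'] := natP _ tal'.
by rewrite alE em' ler_nat; apply: hmin; apply/asboolP; exists al'.
Qed.

Section Minimal.
Variable al : 'I_3 -> V.
Hypothesis tal : a2_triple al.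
Hypothesis almin : forall al', a2_triple al' -> ht (\sum_e al e) <= ht (\sum_e al' e).

Let al_pos : forall e, pos_root A (al e) := proj1 tal.

Lemma triple_form e f : e != f -> '[al e, al f] = - 1.
Proof.
move=> ef; case: tal => _ [t [c alE]].
by rewrite !alE !formlin !rk !(rad_r rk) a2_dir_form //; case: t {alE}; rewrite ?expr0 ?expr1; ring.
Qed.

Local Notation delta := (a2_delta al).

Let d_rad : rad delta := rad_delta al_pos triple_form.
Let d_ht : 0 < ht delta := delta_ht al_pos.
Let d_sum e f g : uniq [:: e; f; g] -> delta = al e + al f + al g.
Proof. exact: delta_sum. Qed.
Let d_sub e f g : uniq [:: e; f; g] -> al g = delta - al e - al f.
Proof. by move=> u; rewrite (d_sum u); apply/rowP => i; rewrite !mxE; ring. Qed.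

Lemma triple_delta (t : bool) (c : 'I_3 -> R) :
  (forall e, al e = (-1) ^+ t *: a2_dir e + c e *: k) -> delta = (\sum_e c e) *: k.
Proof.
move=> alE; rewrite /a2_delta (eq_bigr _ (fun e _ => alE e)) big_split /= -scaler_sumr.
by rewrite a2_dir_sum scaler0 add0r scaler_suml.
Qed.

Lemma triple_signed x : is_root A x -> a2_plane x ->
  exists (t : bool) e (c : R), x = (-1) ^+ t *: al e + c *: delta.
Proof.
move=> rx px; have [t [e [c ->]]] := a2_plane_dir rx px.
case: tal => _ [t0 [c0 alE]].
have dE := triple_delta alE.
have c1 : \sum_e c0 e != 0.
  by apply/eqP => c00; move: d_ht; rewrite dE c00 scale0r /ht big1 ?ltxx // => i _; rewrite mxE.
exists (t (+) t0), e, ((c - (-1) ^+ (t (+) t0) * c0 e) / \sum_e c0 e).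
rewrite dE scalerA divfK // alE scalerDr !scalerA -signr_addb addbK -addrA -scalerDl.
by congr (_ + _ *: _); ring.
Qed.

(** Replacing [al e] by this root gives another triple, whose total height differs by
    [c * ht delta]. *)
Lemma triple_plus e (c : R) : pos_root A (al e + c *: delta) -> 0 <= c.
Proof.
move=> hp; case: tal => _ [t0 [c0 alE]].
pose al' f := if f == e then al e + c *: delta else al f.
have dE := triple_delta alE.
have tal' : a2_triple al'.
  split=> [f|]; first by rewrite /al'; case: eqP.
  exists t0, (fun f => if f == e then c0 e + c * \sum_e c0 e else c0 f) => f.
  rewrite /al'; case: eqP => [->|_]; last exact: alE.
  by rewrite dE alE scalerA -addrA -scalerDl.
have := almin tal'; have [f [g u]] := ord3_others e; have [ef eg fg] := uniq3P u.
have := delta_sum al' u; rewrite /a2_delta => ->; rewrite -/(a2_delta al).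
have -> : al' e = al e + c *: delta by rewrite /al' eqxx.
have -> : al' f = al f by rewrite /al' eq_sym (negPf ef).
have -> : al' g = al g by rewrite /al' eq_sym (negPf eg).
rewrite {1}(d_sum u) !htD htZ => h; have h' : 0 <= c * ht delta by lra.
by rewrite pmulr_lge0 in h'.
Qed.

(** If [c < 1], subtracting [al f] or [al g] gives a root that [triple_plus] forces to be negative.
    So [-al e + c delta], [-al f + (1 - c) delta], [-al g + (1 - c) delta] form a triple with sum
    [(1 - c) delta]. Minimality gives [c <= 0], and the first root has negative height. *)
Lemma triple_minus e (c : R) : pos_root A (- al e + c *: delta) -> 1 <= c.
Proof.
move=> hp; rewrite leNgt; apply/negP => c1.
have [f [g u]] := ord3_others e; have [ef eg fg] := uniq3P u.
have [rw pw] := (pos_rootE _).1 hp.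
have neg f0 g0 : uniq [:: e; f0; g0] -> pos_root A (- al g0 + (1 - c) *: delta).
  move=> u0; have [ef0 _ _] := uniq3P u0.
  have fm : '[- al e + c *: delta, al f0] = 1.
    by rewrite !formlin d_rad triple_form //; ring.
  have := root_sub rw (al_pos f0).1 fm.
  have -> : - al e + c *: delta - al f0 = al g0 + (c - 1) *: delta.
    by rewrite (d_sub u0); apply/rowP => i; rewrite !mxE; ring.
  case/root_pos_or => [/triple_plus|]; first by move=> h; exfalso; apply: (@one_le0F R); lra.
  by congr pos_root; apply/rowP => i; rewrite !mxE; ring.
have hg := neg _ _ u; have hf := neg _ _ (uniq3C (uniq3R (uniq3R u))).
case: tal => _ [t0 [c0 alE]].
have dE := triple_delta alE.
pose al' h := - al h + (if h == e then c else 1 - c) *: delta.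
have tal' : a2_triple al'.
  split=> [h|].
    rewrite /al'; have [->//|he] := eqVneq h e.
    have [->|hf'] := eqVneq h f; first exact: hf.
    suff -> : h = g by [].
    apply/eqP; apply: contraT => hg'; have : uniq [:: e; f; g; h].
      by rewrite /= !inE !negb_or ef eg fg eq_sym he eq_sym hf' eq_sym hg'.
    by move/card_uniqP => ch; have := max_card (mem [:: e; f; g; h]); rewrite ch card_ord.
  exists (~~ t0), (fun h => - c0 h + (if h == e then c else 1 - c) * \sum_e c0 e) => h.
  rewrite /al' dE alE; move: (\sum_e c0 e) => S.
  by case: (t0); apply/rowP => i; rewrite !mxE /= ?expr0 ?expr1; ring.
have := almin tal'; have := delta_sum al' u; rewrite /a2_delta => ->; rewrite -/(a2_delta al).
rewrite /al' eqxx ![_ == e]eq_sym (negPf ef) (negPf eg) !htD !htN !htZ.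
have : ht delta = ht (al e) + ht (al f) + ht (al g) by rewrite (d_sum u) !htD.
move=> hd h; have c0' : c * ht delta <= 0 by lra.
have := pos_root_ht hp; rewrite htD htN htZ; have := pos_root_ht (al_pos e).
by move=> h1 h2; apply: (@one_le0F R); lra.
Qed.

(** The coefficient [c] of [delta] is a priori real. Subtracting suitable roots with form 1 lowers
    it by one among positive roots, and the two preceding bounds stop this only at a root of the
    expected shape. *)
Lemma triple_frame x : pos_root A x -> a2_plane x -> exists t e p, x = a2_root al t e p.
Proof.
move=> hx px; have [t [e [c xE]]] := triple_signed hx.1 px.
suff [p cp] : exists p : nat, c = (p + t)%:R by exists t, e, p; rewrite /a2_root -cp.
have [N cN] : exists N : nat, c < N%:R.
  by exists (Num.bound `|c|); apply: le_lt_trans (ler_norm _) (archi_boundP _).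
rewrite xE in hx; elim: N t e c cN hx {x px xE} => [|N IH] t e c cN hx.
  exfalso; apply: (@one_le0F R); move: hx; case: t; rewrite ?expr0 ?expr1 ?scaleN1r ?scale1r.
    by move/triple_minus; lra.
  by move/triple_plus; lra.
have [f [g u]] := ord3_others e; have [ef eg fg] := uniq3P u; rewrite -natr1 in cN.
case: t hx; rewrite ?expr0 ?expr1 ?scaleN1r ?scale1r => hx.
  have c1 := triple_minus hx.
  have fm : '[- al e + c *: delta, al f] = 1 by rewrite !formlin d_rad triple_form //; ring.
  have := root_sub hx.1 (al_pos f).1 fm.
  have -> : - al e + c *: delta - al f = al g + (c - 1) *: delta.
    by rewrite (d_sub u); apply/rowP => i; rewrite !mxE; ring.
  case/root_pos_or => h.
    have [||p cp] := IH false g (c - 1); first by lra.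
      by rewrite expr0 scale1r.
    by exists p; rewrite addn1 -natr1 -[p]addn0 -cp; ring.
  exfalso; have h' : pos_root A (- al g + (1 - c) *: delta).
    by move: h; congr pos_root; apply/rowP => i; rewrite !mxE; ring.
  by have := triple_minus h' => h1; apply: (@one_le0F R); lra.
have c0 := triple_plus hx; have [->|cn0] := eqVneq c 0; first by exists 0%N.
have cp : 0 < c by rewrite lt_neqAle eq_sym cn0.
have ref : is_root A (al e + al f) by apply: root_add; rewrite ?triple_form //; apply: (al_pos _).1.
have fm : '[al e + c *: delta, al e + al f] = 1.
  by rewrite !formlin !d_rad (triple_form ef) (root_norm (al_pos e).1); ring.
have := root_sub hx.1 ref fm.
have -> : al e + c *: delta - (al e + al f) = - al f + c *: delta.
  by apply/rowP => i; rewrite !mxE; ring.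
case/root_pos_or => h; last first.
  exfalso; have h' : pos_root A (al f + (- c) *: delta).
    by move: h; congr pos_root; apply/rowP => i; rewrite !mxE; ring.
  by have := triple_plus h' => h1; apply: (@one_le0F R); lra.
have c1 := triple_minus h.
have fm' : '[- al f + c *: delta, al g] = 1.
  by rewrite !formlin d_rad triple_form //; ring.
have := root_sub h.1 (al_pos g).1 fm'.
have -> : - al f + c *: delta - al g = al e + (c - 1) *: delta.
  by rewrite (d_sub u); apply/rowP => i; rewrite !mxE; ring.
case/root_pos_or => h2; last first.
  exfalso; have h' : pos_root A (- al e + (1 - c) *: delta).
    by move: h2; congr pos_root; apply/rowP => i; rewrite !mxE; ring.
  by have := triple_minus h' => h1; apply: (@one_le0F R); lra.
have [||p cp'] := IH false e (c - 1); first by lra.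
  by rewrite expr0 scale1r.
by exists p.+1; rewrite addn0 -natr1 -[p]addn0 -cp'; ring.
Qed.

End Minimal.
End Frame.

(** * Choice of the full subset *)

Lemma line_clean a k (Z : V -> Prop) : pos_root A a -> rad k -> nonneg k ->
  (forall x, Z x -> pos_root A x /\ exists p q : R, x = p *: a + q *: k) -> clean Z.
Proof.
move=> pa rk pk hZ.
have hht : linear_in ht by move=> p u v; rewrite htD htZ.
have ha := pos_root_ht pa; have [k0|nk] := pselect (k = 0).
  apply: (planar_clean (e := (ht a)^-1 *: a) (f := 0) (h := ht) (g := fun=> 0)) => //.
    by move=> p u v; rewrite mulr0 addr0.
  move=> x /hZ[/pos_root_ht hx [p [q xE]]]; split; first by lra.
  by rewrite xE k0 !scaler0 !addr0 htZ scalerA mulfK // gt_eqF //; lra.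
have hk := ht_gt0 pk nk.
(* [e] has height 1 and [f] is [a] shifted along [k] to height 0, so the height and half the pairing
   with [a] are the coordinates. *)
apply: (planar_clean (e := (ht k)^-1 *: k) (f := a - (ht a / ht k) *: k) (h := ht)
   (g := fun x => '[x, a] / 2)) => //.
  by move=> p u v; rewrite !formlin; field.
move=> x /hZ[/pos_root_ht hx [p [q xE]]]; split; first by lra.
rewrite xE !formlin rk (root_norm pa.1) htD !htZ.
by apply/rowP => i; rewrite !mxE; field; rewrite gt_eqF.
Qed.

Lemma closed_in_sub (Z Z0 B : V -> Prop) : Defs.subset Z0 Z -> closed_in Z B ->
  closed_in Z0 (fun x => B x /\ Z0 x).
Proof.
move=> hs [_ cB]; split; first by move=> x [].
by move=> x y z [Bx _] [By _] sp Zz; split=> //; apply: cB Bx By sp (hs _ Zz).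
Qed.

(** Pairing with [c] reads off the coefficient of [c] in both expressions of [v]. The coefficients
    agree, but [c] has only one colour, so both vanish. *)
Lemma clean_adjoin (Z Z0 : V -> Prop) c : Defs.subset Z0 Z ->
  (forall x, Z x -> Z0 x \/ x = c) -> (forall x, Z0 x -> '[x, c] = 0) -> '[c, c] = 2 ->
  clean Z0 -> clean Z.
Proof.
move=> hs hZ orth cc cl B BZ [cB cC] v vB vC.
set C := setminus Z B in vC cC.
have CZ : Defs.subset C Z by move=> x [].
have split_c (D : V -> Prop) w : Defs.subset D Z -> nspan D w -> exists w0 q,
    [/\ nspan (fun x => D x /\ Z0 x) w0, w = w0 + q *: c, '[w, c] = q * 2 & q <> 0 -> D c].
  move=> DZ [s [hsD ->]]; elim: s hsD => [|p s IH] hsD.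
    exists 0, 0; split=> //; rewrite ?big_nil ?scale0r ?addr0 ?form0l ?mul0r //.
    by exists [::]; rewrite big_nil.
  have [p0 Dp] := hsD p (mem_head _ _).
  have [w0 [q [[s0 [hs0 w0E]] wE wc hq]]] := IH (fun q hq => hsD q (mem_behead (s := p :: s) hq)).
  have [Zp|pc] := hZ _ (DZ _ Dp).
    exists (p.1 *: p.2 + w0), q; split=> //.
    - exists (p :: s0); rewrite big_cons w0E; split=> // r.
      by rewrite in_cons => /orP[/eqP->|/hs0].
    - by rewrite big_cons wE addrA.
    - by rewrite big_cons formDl formZl orth // wc mulr0 add0r.
  exists w0, (p.1 + q); split.
  - by exists s0.
  - by rewrite big_cons wE pc scalerDl addrCA.
  - by rewrite big_cons formDl formZl pc cc wc mulrDl.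
  - by rewrite -pc.
have [b0 [q [sb vb fb hb]]] := split_c B v BZ vB.
have [c0 [q' [sc vc fc hc]]] := split_c C v CZ vC.
have qq : q = q' by lra.
have q0 : q = 0.
  have [//|/eqP qn] := eqVneq q 0; have Bc := hb qn.
  by rewrite qq in qn; have [] := hc qn.
apply: (cl (fun x => B x /\ Z0 x)).
- by move=> x [].
- split; first exact: closed_in_sub hs cB.
  have := closed_in_sub hs cC; congr closed_in; apply/funext => x; apply/propext.
  split=> [[[Zx nB] Z0x]|[Z0x nB]]; first by split=> // -[].
  by split=> //; split; [exact: hs|move=> Bx; apply: nB].
- by rewrite vb q0 scale0r addr0.
- rewrite vc -qq q0 scale0r addr0.
  have [s [hs' ->]] := sc; exists s; split=> // p /hs' [p0 [[Zx nB] Z0x]].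
  by split=> //; split=> // -[].
Qed.

Lemma full_linear (L : V -> Prop) : linear_closed_set L ->
  full (pos_root A) (fun x => pos_root A x /\ L x).
Proof.
move=> hL; split; first by move=> x [].
move=> a b [_ La] [_ Lb] v /lspan_pairE[p [q vE]]; split=> [[]//|Xv]; split=> //.
have L0 : L 0 by rewrite -(subrr a); apply: linear_closed_setB.
by rewrite vE; apply: (hL) => //; rewrite -[_ *: b]addr0; apply: hL.
Qed.

Section Ordered.
Variable r : V -> nat.
Hypothesis href : refines_root_poset A r.

Definition in_clean_full m a b c := exists F, full (pos_root A) F /\ F a /\ F b /\ F c /\
  clean (fun x => F x /\ init_seg (pos_root A) r m x).

Definition span3 a b c x := exists p q s : R, x = p *: a + q *: b + s *: c.

Lemma span3_linear a b c : linear_closed_set (span3 a b c).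
Proof.
move=> p u v [p1 [q1 [s1 ->]]] [p2 [q2 [s2 ->]]].
exists (p * p1 + p2), (p * q1 + q2), (p * s1 + s2).
by apply/rowP => i; rewrite !mxE; ring.
Qed.

Lemma span3_1 a b c : span3 a b c a.
Proof. by exists 1, 0, 0; rewrite scale1r !scale0r !addr0. Qed.
Lemma span3_2 a b c : span3 a b c b.
Proof. by exists 0, 1, 0; rewrite scale1r !scale0r addr0 add0r. Qed.
Lemma span3_3 a b c : span3 a b c c.
Proof. by exists 0, 0, 1; rewrite scale1r !scale0r !add0r. Qed.

Lemma init_ideal m (L : V -> Prop) :
  ideal_of L (fun x => (pos_root A x /\ L x) /\ init_seg (pos_root A) r m x).
Proof.
split=> [x [] //|x y [[Xx Lx] [_ rx]] Xy Ly hxy]; split=> //; split=> //.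
have [->//|nxy] := pselect (y = x); apply: ltn_trans rx.
by apply: href => //; apply/nspan_PiE.
Qed.

Lemma in_clean_full_span3 m a b c : pos_root A a -> pos_root A b -> pos_root A c ->
  clean (fun x => (pos_root A x /\ span3 a b c x) /\ init_seg (pos_root A) r m x) ->
  in_clean_full m a b c.
Proof.
move=> Xa Xb Xc hc; exists (fun x => pos_root A x /\ span3 a b c x); split.
  exact: full_linear (@span3_linear a b c).
split; first by split=> //; apply: span3_1.
split; first by split=> //; apply: span3_2.
by split; first by split=> //; apply: span3_3.
Qed.

Lemma in_clean_full_swap m a b c : in_clean_full m a b c -> in_clean_full m b a c.
Proof. by case=> F [h1 [h2 [h3 [h4 h5]]]]; exists F. Qed.

Lemma in_clean_full_rot m a b c : in_clean_full m a b c -> in_clean_full m b c a.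
Proof. by case=> F [h1 [h2 [h3 [h4 h5]]]]; exists F. Qed.

(** The span of [a], [b] is definite, so an isotropic vector of the whole span involves [c]. Without
    one the definite case applies; with one the span carries an A2~ system. *)
Lemma in_clean_full_A2 m a b c : pos_root A a -> pos_root A b -> pos_root A c ->
  '[a, b] = 1 \/ '[a, b] = - 1 -> in_clean_full m a b c.
Proof.
move=> Xa Xb Xc hab; apply: in_clean_full_span3 => //.
have [b' [b'E ab']] : exists b', (b = b' \/ b = - b') /\ '[a, b'] = - 1.
  case: hab => h; last by exists b; split=> //; left.
  by exists (- b); split; [right; rewrite opprK|rewrite formNr h].
have rb' : is_root A b'.
  case: b'E => [<-|bE]; first exact: Xb.1.
  by rewrite -[b']opprK -bE; apply: rootN; exact: Xb.1.
have ra := Xa.1.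
have spanE x : span3 a b c x <-> span3 a b' c x.
  case: b'E => -> //; split=> -[p [q [s ->]]]; exists p, (- q), s.
    by rewrite scalerN scaleNr.
  by rewrite scalerN scaleNr opprK.
have [hR|] := pselect (forall x, span3 a b c x -> rad x -> x = 0).
  exact: finite_clean (@span3_linear a b c) (init_ideal m _) hR.
move=> /existsNP[x0 /not_implyP[/spanE[p [q [s x0E]]] /not_implyP[rx0 nx0]]].
have s0 : s != 0.
  apply/eqP => s0; move: x0E; rewrite s0 scale0r addr0 => x0E.
  have := rx0 a; have := rx0 b'; rewrite x0E !formlin ab' (formC b' a) ab' !root_norm // => h1 h2.
  have p0 : p = 0 by lra. have q0 : q = 0 by lra.
  by apply: nx0; rewrite x0E p0 q0 !scale0r addr0.
pose k := s^-1 *: x0.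
have rk : rad k by apply: radZ.
have nk : k <> 0 by move/eqP; rewrite scaler_eq0 invr_eq0 (negPf s0) => /eqP.
have cE : c = (- p / s) *: a + (- q / s) *: b' + k.
  by rewrite /k x0E; apply/rowP => i; rewrite !mxE; field.
have planeE x : span3 a b c x <-> a2_plane a b' k x.
  rewrite spanE; split=> -[p1 [q1 [s1 ->]]].
    exists (p1 - s1 * (p / s)), (q1 - s1 * (q / s)), s1.
    by rewrite cE; apply/rowP => i; rewrite !mxE; ring.
  exists (p1 + s1 * (p / s)), (q1 + s1 * (q / s)), s1.
  by rewrite cE; apply/rowP => i; rewrite !mxE; ring.
have rc := Xc.1.
(* Modulo [k], [c] is a root [u] of the A2 system of [a], [b']. Thus [u] and [u + k] are both roots,
   which supplies the translations along [k]. *)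
have [t [e uE]] := hexagon_dir ra rb' ab' rk (eq_ind _ (is_root A) rc _ cE).
pose u : V := (-1) ^+ t *: a2_dir a b' e.
have cuk : c = u + k by rewrite {1}cE uE.
have ru : is_root A u.
  have h := a2_dir_root ra rb' ab' e.
  by rewrite /u; case: (t); rewrite ?expr0 ?expr1 ?scale1r // scaleN1r; apply: rootN.
have [|f|al0 tal0] := a2_triple_exists ra rb' ab' rk nk ru.
- by rewrite -cuk.
- rewrite /u formZr mulf_eq0 signr_eq0 /=; have [->|ef] := eqVneq f e.
    by rewrite a2_dir_norm //; apply/eqP; lra.
  by rewrite a2_dir_form //; apply/eqP; lra.
have [al tal almin] := a2_triple_min tal0.
have all_al f : span3 a b c (al f).
  by apply/planeE; case: tal => _ [t' [c' alE]]; rewrite alE; apply: a2_dir_plane.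
apply: (affine_A2_clean (al := al) (L := span3 a b c)).
- exact: (proj1 tal).
- by move=> f g; apply: (triple_form ra rb' ab' rk tal).
- exact: span3_linear.
- exact: all_al.
- exact: init_ideal.
- by move=> x Xx /planeE px; apply: (triple_frame ra rb' ab' rk tal almin).
Qed.

Lemma form2_signed a b : pos_root A a -> pos_root A b -> '[a, b] = 2 \/ '[a, b] = - 2 ->
  exists b', [/\ b = b' \/ b = - b', is_root A b' & rad (b' - a)].
Proof.
move=> [ra _] [rb _] [] h.
  by exists b; split=> //; [left|rewrite -opprB; apply: radN; apply: form2_rad].
exists (- b); split; [by right; rewrite opprK|exact: rootN|].
by rewrite -opprD addrC; apply: radN; apply: formN2_rad.
Qed.

Lemma in_clean_full_line m a b c : pos_root A a -> pos_root A b -> pos_root A c ->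
  '[a, b] = 2 \/ '[a, b] = - 2 -> '[a, c] = 2 \/ '[a, c] = - 2 -> in_clean_full m a b c.
Proof.
move=> Xa Xb Xc hb hc; apply: in_clean_full_span3 => //.
have [b' [bE rb' rad_b]] := form2_signed Xa Xb hb.
have [c' [cE rc' rad_c]] := form2_signed Xa Xc hc.
have [k [rk pk [p b'E] [q c'E]]] := rad_diff_dep Xa.1 rb' rc' rad_b rad_c.
apply: (line_clean Xa rk pk) => x [[Xx [p1 [q1 [s1 xE]]]] _]; split=> //.
have line y y' (z : R) : y = y' \/ y = - y' -> y' = a + z *: k ->
    exists u w : R, y = u *: a + w *: k.
  move=> [] -> ->; first by exists 1, z; rewrite scale1r.
  by exists (-1), (- z); rewrite scaleN1r scaleNr opprD.
have [p2 [q2 b2]] := line _ _ _ bE b'E; have [p3 [q3 c3]] := line _ _ _ cE c'E.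
exists (p1 + q1 * p2 + s1 * p3), (q1 * q2 + s1 * q3).
by rewrite xE b2 c3; apply/rowP => i; rewrite !mxE; ring.
Qed.

(* When the three roots span two orthogonal affine lines with the same isotropic
   direction, the full linear set is not clean; one line and a single root are. *)
Lemma in_clean_full_A1 m a b c : pos_root A a -> pos_root A b -> pos_root A c ->
  '[a, b] = 2 \/ '[a, b] = - 2 -> '[a, c] = 0 -> in_clean_full m a b c.
Proof.
move=> Xa Xb Xc hab ac.
have [b' [bE rb' rad_b]] := form2_signed Xa Xb hab.
have [k [rk pk [p0 b'E] _]] := rad_diff_dep Xa.1 rb' rb' rad_b rad_b.
have [pb [qb bE']] : exists p q : R, b = p *: a + q *: k.
  case: bE => ->; rewrite b'E; first by exists 1, p0; rewrite scale1r.
  by exists (-1), (- p0); rewrite scaleN1r scaleNr opprD.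
pose L x := exists p q : R, x = p *: a + q *: k.
have L_lin : linear_closed_set L.
  move=> p u v [p1 [q1 ->]] [p2 [q2 ->]]; exists (p * p1 + p2), (p * q1 + q2).
  by apply/rowP => i; rewrite !mxE; ring.
have Lc x : L x -> '[x, c] = 0 by move=> [p [q ->]]; rewrite !formlin ac rk !mulr0 addr0.
have La : L a by exists 1, 0; rewrite scale1r scale0r addr0.
have Lb : L b by exists pb, qb.
have [fs fl] := full_linear L_lin.
have rc := Xc.1.
have mult x v p : pos_root A x -> pos_root A v -> v = p *: x -> v = x.
  move=> Xx Xv vE; have [//|nvx] := pselect (v = x).
  have [|h _] := pos_root_indep (p := 1) (q := - p) Xv Xx nvx.
    by rewrite vE scale1r scaleNr subrr.
  by exfalso; apply: (@one_le0F R); lra.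
(* Fullness across the two pieces: the plane of [x] and the orthogonal root [c] contains no further
   positive root. *)
have mixed x v (p q : R) : pos_root A x -> L x -> pos_root A v -> v = p *: x + q *: c ->
    v = x \/ v = c.
  move=> Xx Lx Xv vE.
  have h1 := form_root_cases Xv.1 Xx.1; have h2 := form_root_cases Xv.1 rc.
  have h3 := root_norm Xv.1.
  have [xc xx cc] : [/\ '[x, c] = 0, '[x, x] = 2 & '[c, c] = 2].
    by split; [exact: Lc|exact: root_norm Xx.1|exact: root_norm].
  rewrite vE !formlin (formC c x) xc xx cc in h1 h2 h3.
  have := @square_coord R p q; rewrite /= => sq.
  have : p = 0 \/ q = 0.
    apply: sq; last by lra.
    + by have -> : 2 * p = p * 2 + q * 0 by ring.
    + by have -> : 2 * q = p * 0 + q * 2 by ring.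
  case=> e0; move: vE; rewrite e0 scale0r ?add0r ?addr0 => vE; [right|left].
    exact: mult vE.
  exact: mult vE.
exists (fun x => (pos_root A x /\ L x) \/ x = c).
split; last split; last split; last split; [|by left|by left|by right|].
- split=> [x [[]|->] //|x y hx hy v hv].
  split=> [[[]//|->//]|Xv].
  case: hx hy hv => [[Xx Lx]|->] [[Xy Ly]|->] hv.
  + by left; apply/(fl x y _ _ v hv).
  + have /lspan_pairE[p [q vE]] := hv.
    by case: (mixed x v p q Xx Lx Xv vE) => ->; [left|right].
  + have /lspan_pairE[p [q vE]] := hv; rewrite addrC in vE.
    by case: (mixed y v q p Xy Ly Xv vE) => ->; [left|right].
  + have /lspan_pairE[p [q vE]] := hv; rewrite -scalerDl in vE.
    by right; apply: mult vE.
- apply: (clean_adjoin (c := c)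
    (Z0 := fun x => (pos_root A x /\ L x) /\ init_seg (pos_root A) r m x)).
  + by move=> x [h1 h2]; split=> //; left.
  + by move=> x [[h|->] h2]; [left|right].
  + by move=> x [[_ /Lc]].
  + exact: root_norm.
  + by apply: (line_clean Xa rk pk) => x [[Xx Lx] _]; split.
Qed.

Lemma in_clean_full_all m a b c : pos_root A a -> pos_root A b -> pos_root A c -> in_clean_full m a b c.
Proof.
move=> Xa Xb Xc.
have key x y : pos_root A x -> pos_root A y ->
    ('[x, y] = 1 \/ '[x, y] = - 1) \/ ('[x, y] = 2 \/ '[x, y] = - 2) \/ '[x, y] = 0.
  by move=> [rx _] [ry _]; case: (form_root_cases rx ry) => [|[|[|[|]]]] ->; auto.
have [hab|hab] := key _ _ Xa Xb; first exact: in_clean_full_A2.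
have [hac|hac] := key _ _ Xa Xc; first by apply: in_clean_full_rot; apply: in_clean_full_swap; apply: in_clean_full_A2.
have [hbc|hbc] := key _ _ Xb Xc; first by apply: in_clean_full_rot; apply: in_clean_full_rot; apply: in_clean_full_A2.
have ba0 : '[a, b] = 0 -> '[b, a] = 0 by rewrite formC.
case: hab => hab.
  by case: hac => hac; [exact: in_clean_full_line|exact: in_clean_full_A1].
case: hac => hac.
  by apply: in_clean_full_rot; apply: in_clean_full_swap; apply: in_clean_full_A1.
case: hbc => hbc.
  by apply: in_clean_full_rot; apply: in_clean_full_rot; apply: in_clean_full_A1; rewrite // formC.
(* The remaining case is three mutually orthogonal roots, whose span is definite. *)
apply: in_clean_full_span3 => //; apply: finite_clean (@span3_linear a b c) (init_ideal m _) _.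
move=> x [p [q [s xE]]] rx; have := rx a; have := rx b; have := rx c.
rewrite xE !formlin (formC b a) (formC c a) (formC c b) hab hac hbc.
rewrite (root_norm Xa.1) (root_norm Xb.1) (root_norm Xc.1) => h1 h2 h3.
have -> : p = 0 by lra. have -> : q = 0 by lra. have -> : s = 0 by lra.
by rewrite !scale0r !addr0.
Qed.

End Ordered.

End RootSystem.

Theorem theorem6p1 (R : realType) (n : nat) (A : 'M[int]_n)
  (hA : simply_laced_cartan A) (hfa : @finite_or_affine R n A)
  (r : 'rV[R]_n -> nat)
  (hord : ordering (pos_root A) r)
  (href : refines_root_poset A r) :
  suitable (pos_root A) r.
Proof.
split=> [Y hY a b hab c Yc ca cb|m a b c [Xa _] [Xb _] [Xc _]]; last first.
  exact: in_clean_full_all.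
have [/nspan_PiE ac /nspan_PiE bc] := fundamental_below hA hfa hY hab Yc ca cb.
have [a0 [b0 [_ [_ [_ YE]]]]] := hY; have [Ya [Yb _]] := hab.
have [[Xa _] [Xb _] [Xc _]] := And3 ((YE a).1 Ya) ((YE b).1 Yb) ((YE c).1 Yc).
by split; apply: href => // e; [apply: ca|apply: cb].
Qed.
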